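(* Let $n \geq r \geq 3$ be integers and let $H$ be an $n$-vertex $r$-uniform hypergraph. Suppose that one of the following holds: (1) $r \leq n/2$ and $\delta(H) \geq \binom{\lfloor n/2 \rfloor}{r-1} + 1$; or (2) $r > n/2 \geq 3$ and $\delta(H) \geq r-1$; or (3) $r = 3$, $n = 5$ and $\delta(H) \geq 3$. Then $H$ is hamiltonian-connected, i.e., for any two distinct vertices $x,y \in V(H)$, $H$ contains a hamiltonian Berge path from $x$ to $y$.
   Context: An $r$-uniform hypergraph ($r$-graph) is a hypergraph all of whose edges have exactly $r$ vertices. The degree $d_H(v)$ of a vertex $v$ is the number of edges containing $v$, and $\delta(H)$ is the minimum degree over all vertices. A Berge path of length $\ell$ is a list $v_1, e_1, v_2, \ldots, e_\ell, v_{\ell+1}$ of $\ell+1$ distinct vertices and $\ell$ distinct edges with $\{v_i, v_{i+1}\} \subseteq e_i$ for all $1 \leq i \leq \ell$; it is an $x,y$-path if $v_1 = x$ and $v_{\ell+1} = y$, and it is hamiltonian if its vertex list $\{v_1,\dots,v_{\ell+1}\}$ is all of $V(H)$ (edges may contain further vertices). A hypergraph is hamiltonian-connected if for any two distinct vertices $x,y$ it contains a hamiltonian Berge $x,y$-path. *)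

(* Defs.v *)
From mathcomp Require Import all_boot.

Set Implicit Arguments.
Unset Strict Implicit.
Unset Printing Implicit Defensive.

(** A hypergraph on the vertex set [V] is given by its set of edges
    [H : {set {set V}}]; there are no multiple edges. *)

Section Hypergraph.

Variable V : finType.
Implicit Types (H : {set {set V}}) (x y v : V) (p : seq V)
  (es : seq {set V}).

Definition uniform (r : nat) H := forall e, e \in H -> #|e| = r.

Definition degree H v : nat := #|[set e in H | v \in e]|.

(** Degrees are at most [#|H|], so the default value [#|H|] of the iterated
    minimum does not affect the result when [V] is nonempty. *)
Definition min_degree H : nat := \big[minn/#|H|]_(v : V) degree H v.

(** The vertex list of the path is [v1 :: p] and its edge list is [es], so the
    length of the path is [size es]; both lists are indexed from 0. *)
Definition berge_path H v1 p es : Prop :=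
  [/\ size p = size es,
      uniq (v1 :: p),
      uniq es,
      {subset es <= H}
    & forall i, i < size es ->
        [set nth v1 (v1 :: p) i; nth v1 (v1 :: p) i.+1]
          \subset nth set0 es i].

Definition hamiltonian_berge_path H x y p es : Prop :=
  [/\ berge_path H x p es,
      last x p = y
    & [set v in x :: p] = [set: V]].

Definition hamiltonian_connected H : Prop :=
  forall x y, x != y -> exists p es, hamiltonian_berge_path H x y p es.

End Hypergraph.

(* Main.v *)
From Stdlib Require Import Classical_Prop.
Require Import Defs.
From mathcomp Require Import all_boot zify.

(* Add r-sets to H one at a time until a hamiltonian x,y-path appears. If its last added
   r-set is deleted from the path and the two remaining pieces are joined through the pair
   {x, y}, one obtains a spanning Berge path of H that uses {x, y} as an extra edge (a state).
   If some free edge, i.e. an edge of H not on this path, contains both of its ends, then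
   it closes the path to a cycle through {x, y}, hence H has a hamiltonian x,y-path.

   Otherwise consider Posa rotations, and exchanges of an edge of the path with a free edge
   through the same two consecutive vertices. They show that the positions before a free
   neighbour of the first end, the positions of the free neighbours of the last end, and the
   positions of the edges of the path that contain an end are almost disjoint. Since an end of
   small degree in the free edges lies in many edges of the path, the degree condition leaves
   only a few pairs of sizes for the two free neighbourhoods. They are excluded one by one:
   mostly, a rotation or an exchange frees an edge that is then forced to have the same
   vertices as a free edge, or more than r vertices. *)

Set Implicit Arguments.
Unset Strict Implicit.
Unset Printing Implicit Defensive.

(** Since the pair {x, y} is one label inside the spanning path, both ends of the path can be moved,
    which rotations of a path with the fixed ends [x] and [y] would not allow. The price is that
    this label can be neither rotated through nor exchanged: hence the recurring exception of the
    position [sp S]. It is the only position where the two free neighbourhoods may overlap, so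
    together they can reach [m.+1] elements on [m] positions. The summand 1 in the bound for small
    uniformity has its own use: an end with at most k free neighbours (k is half of the order,
    rounded down) lies in an edge that leaves these neighbours, and such an edge must be a label.
    Several contradictions start from such labels. When the order is odd, that is [m = k.*2], one
    more position is left to spare, and most of the work goes into this case. *)

Lemma bin_ge_upper N j : 0 < j < N -> N <= 'C(N, j).
Proof.
elim: N j => // N IH [|j] // /andP[_ jN]; rewrite binS.
have [jN'|jN'] := ltnP j.+1 N.
  have := IH j.+1 jN'; have : 0 < 'C(N, j) by rewrite bin_gt0; lia.
  lia.
have -> : N = j.+1 by lia.
by rewrite binn binSn; lia.
Qed.

Lemma bin_ge_double N j : 1 < j -> j.+1 < N -> N.*2 <= 'C(N, j) + 2.
Proof.
elim: N j => // N IH [|[|j]] // _ jN; rewrite binS.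
have U : N <= 'C(N, j.+1) by apply: bin_ge_upper; lia.
have [jN'|jN'] := ltnP j.+3 N; first by have := IH j.+2 isT jN'; lia.
have NE : N = j.+3 by lia.
rewrite {}NE in IH jN jN' U *; rewrite binSn.
by case: j => // j in IH jN jN' U *; have := IH j.+2 isT; lia.
Qed.

(* [p] and [q] stand for the numbers of vertices that share a free edge with the last and
   with the first vertex of a state. *)
Definition nb_sizes (m k r p q : nat) : Prop :=
  (m.+1 = k.*2 /\ (p = k /\ q = k \/ p = k.-1 /\ q = k.-1)) \/
  (m = k.*2 /\
    (p = k /\ q = k.+1 \/ p = k.+1 /\ q = k \/ p = k /\ q = k)) \/
  (m = k.*2 /\ (r = 3 \/ r = k) /\
    (p = k.-1 /\ q = k \/ p = k /\ q = k.-1 \/ p = k.-1 /\ q = k.-1)) \/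
  (m = k.*2 /\ r = k /\ (p = 0 /\ q = k.-1 \/ p = k.-1 /\ q = 0)) \/
  (m = k.*2 /\ k = 4 /\ r = 3 /\ p = 2 /\ q = 2).

(** The degree hypotheses bound the edges at an end by its possible free edges and the positions
    left for its labels. By Pascal's rule, [p < k] forces [q + 'C(k.-1, r.-2) < m], and [p < k.-1]
    costs a further ['C(k.-2, r.-2)]. For [3 < r < k] the first binomial is at least [k.+1], which
    rules out sizes below [k]; for [r = 3] and [r = k] it is only [k.-1], and there the exceptional
    pairs arise. *)
Lemma nb_sizesP m k r p q : m.+1 = k.*2 \/ m = k.*2 -> 2 < r <= k ->
  p + q <= m.+1 -> p <= m -> q <= m -> (p = 0 \/ r.-1 <= p) -> (q = 0 \/ r.-1 <= q) ->
  'C(k, r.-1) + 1 <= 'C(p, r.-1) + (m - q) ->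
  'C(k, r.-1) + 1 <= 'C(q, r.-1) + (m - p) -> 0 < p + q ->
  nb_sizes m k r p q.
Proof.
move=> mk /andP[r2 rk] pq pm qm p0 q0 Dp Dq n0.
have [k' kE] : exists k', k = k'.+2 by exists k.-2; lia.
have [b bE] : exists b, r = b.+3 by exists (r - 3); lia.
have mono i j : i <= j -> 'C(i, b.+2) <= 'C(j, b.+2) by move=> ij; apply: leq_bin2l.
have E1 : 'C(k'.+2, b.+2) = 'C(k'.+1, b.+2) + 'C(k'.+1, b.+1) by rewrite binS.
have E2 : 'C(k'.+1, b.+2) = 'C(k', b.+2) + 'C(k', b.+1) by rewrite binS.
have G1 : k'.+1 <= 'C(k'.+1, b.+1) by apply: bin_ge_upper; lia.
have G2 : 0 < 'C(k', b.+1) by rewrite bin_gt0; lia.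
move: Dp Dq; rewrite bE kE /= E1 => Dp Dq.
have h1 i j : 'C(k'.+1, b.+2) + 'C(k'.+1, b.+1) + 1 <= 'C(i, b.+2) + (m - j) ->
    j <= m -> i <= k'.+1 -> j + 'C(k'.+1, b.+1) < m.
  by move=> D jm /mono; lia.
have h2 i j : 'C(k'.+1, b.+2) + 'C(k'.+1, b.+1) + 1 <= 'C(i, b.+2) + (m - j) ->
    j <= m -> i <= k' -> j + 'C(k'.+1, b.+1) + 'C(k', b.+1) < m.
  by move=> D jm /mono; lia.
have p1 := h1 p q Dp qm; have p2 := h2 p q Dp qm.
have q1 := h1 q p Dq pm; have q2 := h2 q p Dq pm.
rewrite /nb_sizes /= in p0 q0 *; subst k r.
case: (posnP b) => [b0|b0].
  have X1 : 'C(k', b.+1) = k' by rewrite b0 bin1.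
  have X4 : 3 <= k' -> 3 <= 'C(k', b.+2) by move=> /mono; rewrite b0.
  have X5 : 2 <= k' -> 1 <= 'C(k', b.+2) by move=> /mono; rewrite b0.
  have X6 : 'C(k'.+1, b.+1) = k'.+1 by rewrite b0 bin1.
  rewrite X1 X6 in p1 p2 q1 q2 Dp Dq E2.
  (* For [r = 3] an end with two free neighbours lies in at most one free edge; with both sizes at
     most 2 and [k] at least 4, the degree bound survives only for [k = 4]. *)
  have small i j : 'C(k'.+1, b.+2) + k'.+1 + 1 <= 'C(i, b.+2) + (m - j) -> j <= m ->
      (i <= 2 -> j = 2 -> 2 <= k' -> k' = 2 /\ i = 2).
    move=> D jm i2 j2 k2.
    have : 'C(i, b.+2) = (i == 2) by rewrite b0; case: (i) i2 => [|[|[|?]]].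
    by case: eqP => /= i2' B; clear -X4 X5 D jm j2 k2 B i2' i2 E2 mk; lia.
  have sp := small p q Dp qm; have sq := small q p Dq pm.
  clear small X4 X5 E1 E2 G1 G2 Dp Dq h1 h2 mono X1 X6.
  have {}rk : 0 < k' by lia.
  have {}p0 : p != 1 by lia.
  have {}q0 : q != 1 by lia.
  have [pk|pk] := ltnP p k'.+1; have [qk|qk] := ltnP q k'.+1.
  - have {p1 q1} [p2' q2'] : q <= 2 /\ p <= 2 by lia.
    have {p2 q2} [p2 q2] : q + k'.+1 + k' < m /\ p + k'.+1 + k' < m by lia.
    have {}mk : m = k'.+2.*2 by lia.
    have [E|E] : p = 0 /\ q = 2 \/ p = 2 by lia.
      by have E1 : k' = 1; [lia | do 3 right; left; lia].
    have [E1|E1] : q = 0 \/ q = 2 by lia.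
      by have E2 : k' = 1; [lia | do 3 right; left; lia].
    by do 4 right; lia.
  - have {q1 sp sq} p3 := p2 pk; clear p1 p2 q2.
    have [E1 E2] : k' = 1 /\ p = 0 by lia.
    by do 3 right; left; lia.
  - have {p1 sp sq p2} q3 := q2 qk; clear q1 q2.
    have [E1 E2] : k' = 1 /\ q = 0 by lia.
    by do 3 right; left; lia.
  - clear p2 q2 sp sq; have [E1|E1] : m.+1 = k'.+2.*2 \/ m = k'.+2.*2 by [].
      by left; lia.
    have [E2|[E2|E2]] : p = k'.+1 \/ q = k'.+1 \/ (k'.+2 <= p) && (k'.+2 <= q) by lia.
    + by right; right; left; lia.
    + by right; right; left; lia.
    + by right; left; lia.
have [bk|bk] := eqVneq b.+1 k'.
  have X1 : 'C(k', b.+1) = 1 by rewrite bk binn.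
  have X6 : 'C(k'.+1, b.+1) = k'.+1 by rewrite -bk binSn.
  rewrite X1 X6 in p1 p2 q1 q2.
  clear E1 E2 G1 G2 Dp Dq h1 h2 mono X1 X6.
  have [pk|pk] := ltnP p k'.+1; have [qk|qk] := ltnP q k'.+1.
  - by exfalso; clear p1 q1 p2 q2; lia.
  - have {q1 q2} p3 := p2 pk; clear p1 p2; do 3 right; left; lia.
  - have {p1 p2} q3 := q2 qk; clear q1 q2; do 3 right; left; lia.
  - clear p2 q2; have [E1|E1] : m.+1 = k'.+2.*2 \/ m = k'.+2.*2 by [].
      by left; lia.
    have [E2|[E2|E2]] : p = k'.+1 \/ q = k'.+1 \/ (k'.+2 <= p) && (k'.+2 <= q) by lia.
    + by right; right; left; lia.
    + by right; right; left; lia.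
    + by right; left; lia.
have X6 : k'.+3 <= 'C(k'.+1, b.+1) by have := @bin_ge_double k'.+1 b.+1; lia.
have X1 : k' <= 'C(k', b.+1) by apply: bin_ge_upper; lia.
clear E1 E2 G1 G2 Dp Dq h1 h2 mono p0 q0.
(* If [p < k], then first [q] and next [p] drop to at most [k.-2], and the bounds with two binomials
   make both of them 0. *)
have [pk|pk] := ltnP p k'.+2.
  have {}p1 := p1 pk; have qk : q <= k' by clear -p1 X6 mk; lia.
  have {}q2 := q2 qk; have p0 : p <= k' by clear -q2 X6 mk; lia.
  by exfalso; have {}p2 := p2 p0; clear -p2 q2 X6 X1 mk n0; lia.
have [qk|qk] := ltnP q k'.+2.
  by exfalso; have {}q1 := q1 qk; clear -q1 pk X6 mk; lia.
clear p1 q1 p2 q2; case: mk => mk; first by left; lia.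
by right; left; lia.
Qed.

Lemma degree_sum (V : finType) (H : {set {set V}}) r : uniform r H ->
  \sum_(v : V) degree H v = r * #|H|.
Proof.
move=> uH.
have -> : \sum_(v : V) degree H v = \sum_(v : V) \sum_(e in H) (v \in e : nat).
  apply: eq_bigr => v _; rewrite /degree -sum1_card big_mkcond [RHS]big_mkcond /=.
  by apply: eq_bigr => e _; rewrite inE; case: (e \in H).
rewrite exchange_big /= mulnC -sum_nat_const; apply: eq_bigr => e eH.
by rewrite -(uH _ eH) -sum1_card [RHS]big_mkcond.
Qed.

Lemma ex_subset_between (T : finType) (B M : {set T}) j :
  B \subset M -> #|B| <= j <= #|M| -> exists A : {set T},
  [/\ B \subset A, A \subset M & #|A| = j].
Proof.
move=> BM; elim: j => [|j IH] /andP[Bj jM].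
  by exists B; split=> //; apply/eqP; rewrite -leqn0.
have [E|Bj'] := eqVneq #|B| j.+1; first by exists B.
have [|A [BA AM cA]] := IH; first by lia.
have /properP[_ [u uM uA]] : A \proper M by rewrite properEcard AM cA.
exists (u |: A); split.
- exact: subset_trans BA (subsetUr _ _).
- by rewrite subUset sub1set uM.
- by rewrite cardsU1 uA cA.
Qed.

Lemma subsetU1P (T : finType) (A B : {set T}) v : ~~ (A \subset v |: B) ->
  exists u, [/\ u \in A, u != v & u \notin B].
Proof.
by case/subsetPn => u uA; rewrite in_setU1 negb_or => /andP[uv uB]; exists u.
Qed.

(** * States and their moves *)

Section States.

Variables (V : finType) (H : {set {set V}}) (x y : V) (m : nat).
Implicit Types (F : {set {set V}}) (e f : {set V}) (u v : V) (i j l : nat).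

(* A state stands for a spanning Berge path [vx S 0, ..., vx S m] whose edges [lb S 0, ...,
   lb S m.-1] are distinct edges of [H], except that the label at position [sp S] is the
   pair [{x, y}]. Values of [vx] and [lb] beyond these ranges are junk. *)
Record state := State {
  vx : nat -> V;
  lb : nat -> {set V};
  sp : nat }.

Record valid (S : state) : Prop := Valid {
  vx_inj : forall i j, i <= m -> j <= m -> vx S i = vx S j -> i = j;
  lb_inj : forall i j, i < m -> j < m -> lb S i = lb S j -> i = j;
  sp_lt : sp S < m;
  lb_sp : lb S (sp S) = [set x; y];
  lb_vx : forall j, j < m -> (vx S j \in lb S j) && (vx S j.+1 \in lb S j);
  lb_edge : forall j, j < m -> j != sp S -> lb S j \in H }.

Definition vbeg S := vx S 0.
Definition vend S := vx S m.

(* The free edges: the edges of [H] that are not labels. *)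
Definition fr S : {set {set V}} := [set e in H | [forall j : 'I_m, lb S j != e]].

Definition fe (F : {set {set V}}) v := [set e in F | v \in e].

Definition nb (F : {set {set V}}) v :=
  [set u | (u != v) && [exists e in F, (u \in e) && (v \in e)]].

Definition labs S v := [set j : 'I_m | (nat_of_ord j != sp S) && (v \in lb S j)].

Definition JL S := [set j : 'I_m | vx S j \in nb (fr S) (vend S)].
Definition JR S := [set j : 'I_m | vx S j.+1 \in nb (fr S) (vbeg S)].
(* Rotation: [vx S 0, ..., vx S l, vx S m, ..., vx S l.+1], with [e] as the new label. *)
Definition rot S l e := State
  (fun i => if i <= l then vx S i else vx S (m + l.+1 - i))
  (fun j => if j < l then lb S j else if j == l then e else lb S (m + l - j))
  (if sp S < l then sp S else m + l - sp S).

Definition swp S l e := State (vx S)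
  (fun j => if j == l then e else lb S j) (sp S).

Definition mir S := State (fun i => vx S (m - i)) (fun j => lb S (m.-1 - j))
  (m.-1 - sp S).

Lemma frP S e : reflect (e \in H /\ forall j, j < m -> lb S j <> e) (e \in fr S).
Proof.
rewrite inE; apply: (iffP andP) => -[eH fe]; split=> //.
  by move=> j jm eq_e; move/forallP/(_ (Ordinal jm)): fe; rewrite /= eq_e eqxx.
by apply/forallP => j; apply/eqP; apply: fe.
Qed.

Lemma in_fe F v e : (e \in fe F v) = (e \in F) && (v \in e).
Proof. by rewrite inE. Qed.

Lemma in_labs S v (i : 'I_m) :
  (i \in labs S v) = (nat_of_ord i != sp S) && (v \in lb S i).
Proof. by rewrite inE. Qed.

Lemma in_JL S (i : 'I_m) : (i \in JL S) = (vx S i \in nb (fr S) (vend S)).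
Proof. by rewrite inE. Qed.

Lemma in_JR S (i : 'I_m) : (i \in JR S) = (vx S i.+1 \in nb (fr S) (vbeg S)).
Proof. by rewrite inE. Qed.

Lemma fr_edge S e : e \in fr S -> e \in H.
Proof. by case/frP. Qed.

Lemma fr_lb S e j : e \in fr S -> j < m -> lb S j != e.
Proof. by case/frP => _ fe jm; apply/eqP; apply: fe. Qed.

Lemma nbP F u v : reflect (u != v /\ exists2 e, e \in F & (u \in e) /\ (v \in e))
  (u \in nb F v).
Proof.
rewrite inE; apply: (iffP andP) => -[uv].
  by case/exists_inP => e eF /andP[ue ve]; split=> //; exists e.
by case=> e eF [ue ve]; split=> //; apply/exists_inP; exists e; rewrite ?ue.
Qed.

Lemma mem_nb F e u v : e \in F -> u \in e -> v \in e -> u != v -> u \in nb F v.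
Proof. by move=> eF ue ve uv; apply/nbP; split=> //; exists e. Qed.

Lemma nb_sym F u v : (u \in nb F v) = (v \in nb F u).
Proof.
by apply/nbP/nbP => -[uv [e eF [? ?]]]; (split; first by rewrite eq_sym); exists e.
Qed.

Lemma nb_irr F v : v \in nb F v = false.
Proof. by rewrite inE eqxx. Qed.

Lemma nb_sub F e v : e \in F -> v \in e -> e :\ v \subset nb F v.
Proof.
move=> eF ve; apply/subsetP => u; rewrite in_setD1 => /andP[uv ue].
exact: (mem_nb eF ue ve).
Qed.

Section Moves.

Variable S : state.
Hypothesis vS : valid S.

Lemma rot_fr l e : l < m -> e \in fr S -> l != sp S ->
  fr (rot S l e) = lb S l |: (fr S :\ e).
Proof.
move=> lm eF ls; apply/setP => f; rewrite !inE.
have [-> | fl] := eqVneq f (lb S l).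
  rewrite lb_edge //=; apply/forallP => j; rewrite /=; apply/eqP.
  case: ifP => jl; first by move/(lb_inj vS); lia.
  case: eqP => jl'; first by move=> E; case/frP: eF => _ /(_ l lm) [].
  by have := ltn_ord j; move=> jm /(lb_inj vS); lia.
case: (f \in H) => /=; last by rewrite andbF.
apply/forallP/andP => [fN|[fe /forallP fN] j].
  split.
    apply/eqP => fe; have := fN (Ordinal lm); rewrite /= ltnn eqxx fe.
    by rewrite eqxx.
  apply/forallP => j; have jm := ltn_ord j; apply/eqP.
  case: (ltngtP j l) => jl.
  - by have /eqP := fN j; rewrite /= jl.
  - have km : m + l - j < m by lia.
    have /eqP := fN (Ordinal km); rewrite /=.
    case: ifP => [|_]; first lia.
    case: eqP => [|_]; first lia.
    by rewrite (_ : m + l - (m + l - j) = j); last lia.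
  - by rewrite jl => E; rewrite E eqxx in fl.
have jm := ltn_ord j; apply/eqP => /=.
case: ifP => jl; first by apply/eqP/fN.
case: eqP => jl'; first by move=> E; rewrite E eqxx in fe.
have km : m + l - j < m by lia.
by have /eqP := fN (Ordinal km).
Qed.

Lemma rot_fr_lb l : l < m -> fr (rot S l (lb S l)) = fr S.
Proof.
move=> lm; apply/setP => f; rewrite !inE.
case: (f \in H) => //=.
apply/forallP/forallP => fN j; have jm := ltn_ord j; apply/eqP.
  case: (ltngtP j l) => jl.
  - by have /eqP := fN j; rewrite /= jl.
  - have km : m + l - j < m by lia.
    have /eqP := fN (Ordinal km); rewrite /=.
    case: ifP => [|_]; first lia.
    case: eqP => [|_]; first lia.
    by rewrite (_ : m + l - (m + l - j) = j); last lia.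
  - by have /eqP := fN (Ordinal lm); rewrite /= ltnn eqxx jl.
rewrite /=; case: ifP => jl; first by apply/eqP/fN.
case: eqP => jl'; first by have /eqP := fN (Ordinal lm).
have km : m + l - j < m by lia.
by have /eqP := fN (Ordinal km).
Qed.

Lemma rot_valid l e : l < m -> l != sp S -> (e \in fr S) || (e == lb S l) ->
  vx S l \in e -> vend S \in e -> valid (rot S l e).
Proof.
move=> lm ls eF le me.
have sm := sp_lt vS.
have eH : e \in H.
  by case/orP: eF => [/fr_edge //| /eqP->]; apply: lb_edge.
have eN j : j < m -> j != l -> lb S j <> e.
  move=> jm jl E; case/orP: eF => [eF|/eqP el].
    by have := fr_lb eF jm; rewrite E eqxx.
  by move: jl; rewrite (lb_inj vS jm lm) ?eqxx // E.
split=> /=.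
- by move=> i j im jm; case: ifP => il; case: ifP => jl /(vx_inj vS); lia.
- move=> i j im jm; case: ifP => il; last case: eqP => il';
  (case: ifP => jl; last case: eqP => jl'); rewrite ?il' ?jl'.
  + by move/(lb_inj vS); lia.
  + by move/eN; lia.
  + by move/(lb_inj vS); lia.
  + by move/esym/eN; lia.
  + by [].
  + by move/esym/eN; lia.
  + by move/(lb_inj vS); lia.
  + by move/eN; lia.
  + by move/(lb_inj vS); lia.
- by case: ifP; lia.
- case: (ltnP (sp S) l) => sl; first by rewrite sl lb_sp.
  case: ifP => [|_]; first lia.
  case: eqP => [|_]; first lia.
  by rewrite (_ : m + l - (m + l - sp S) = sp S) ?lb_sp //; lia.
- move=> j jm; case: (ltngtP j l) => jl.
  + by rewrite lb_vx.
  + have km : m + l - j < m by lia.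
    have := lb_vx vS km; rewrite andbC.
    by rewrite (_ : (m + l - j).+1 = m + l.+1 - j) 1?(_ : m + l.+1 - j.+1 = m + l - j) //; lia.
  + by rewrite jl le /= (_ : m + l.+1 - l.+1 = m) //; lia.
- move=> j jm js; case: ifP => jl.
    by apply: (lb_edge vS); move: js; case: ifP; lia.
  case: eqP => jl' //; apply: (lb_edge vS); first lia.
  by move: js; case: ifP; lia.
Qed.

Lemma rot_vbeg l e : vbeg (rot S l e) = vbeg S.
Proof. by []. Qed.

Lemma rot_vend l e : l < m -> vend (rot S l e) = vx S l.+1.
Proof. by move=> lm; rewrite /vend /= leqNgt lm /= addnC addnK. Qed.

Lemma swp_fr l e : l < m -> e \in fr S -> l != sp S ->
  fr (swp S l e) = lb S l |: (fr S :\ e).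
Proof.
move=> lm eF ls; apply/setP => f; rewrite !inE.
have [-> | fl] := eqVneq f (lb S l).
  rewrite lb_edge //=; apply/forallP => j; rewrite /=; apply/eqP.
  case: eqP => jl'; first by move=> E; case/frP: eF => _ /(_ l lm) [].
  by have := ltn_ord j; move=> jm /(lb_inj vS); lia.
case: (f \in H) => /=; last by rewrite andbF.
apply/forallP/andP => [fN|[fe /forallP fN] j].
  split.
    by apply/eqP => fe; have := fN (Ordinal lm); rewrite /= eqxx fe eqxx.
  apply/forallP => j; have jm := ltn_ord j; apply/eqP.
  have [->|jl] := eqVneq (j : nat) l; first by move=> E; rewrite E eqxx in fl.
  by have /eqP := fN j; rewrite /= (negPf jl).
rewrite /=; have [_|_] := eqVneq (j : nat) l; last exact: fN.
by rewrite eq_sym.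
Qed.

Lemma swp_valid l e : l < m -> l != sp S -> e \in fr S ->
  vx S l \in e -> vx S l.+1 \in e -> valid (swp S l e).
Proof.
move=> lm ls eF le l1e.
split=> /=.
- exact: vx_inj.
- move=> i j im jm; case: eqP => il; case: eqP => jl; rewrite ?il ?jl //.
  + by move=> E; have := fr_lb eF jm; rewrite E eqxx.
  + by move=> E; have := fr_lb eF im; rewrite E eqxx.
  + exact: lb_inj.
- exact: sp_lt.
- by rewrite eq_sym (negPf ls) lb_sp.
- move=> j jm; case: eqP => [->|_]; first by rewrite le l1e.
  exact: lb_vx.
- move=> j jm js; case: eqP => _; [exact: fr_edge eF | exact: lb_edge].
Qed.

Lemma mir_fr : fr (mir S) = fr S.
Proof.
apply/setP => f; rewrite !inE; case: (f \in H) => //=.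
apply/forallP/forallP => fN j; have jm := ltn_ord j;
  have km : m.-1 - j < m by lia.
  have := fN (Ordinal km); rewrite /= (_ : m.-1 - (m.-1 - j) = j) //; lia.
by have := fN (Ordinal km).
Qed.

Lemma mir_vbeg : vbeg (mir S) = vend S.
Proof. by rewrite /vbeg /= subn0. Qed.

Lemma mir_vend : vend (mir S) = vbeg S.
Proof. by rewrite /vend /= subnn. Qed.

Lemma mir_valid : valid (mir S).
Proof.
have sm := sp_lt vS.
split=> /=.
- by move=> i j im jm /(vx_inj vS); lia.
- by move=> i j im jm /(lb_inj vS); lia.
- lia.
- by rewrite (_ : m.-1 - (m.-1 - sp S) = sp S) ?lb_sp //; lia.
- move=> j jm; have km : m.-1 - j < m by lia.
  have := lb_vx vS km; rewrite andbC.
  by rewrite (_ : (m.-1 - j).+1 = m - j) 1?(_ : m - j.+1 = m.-1 - j) //; lia.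
- by move=> j jm js; apply: (lb_edge vS); move: js; lia.
Qed.

End Moves.

End States.

(* A free edge that contains both ends of a state closes it to a cycle through the pair
   [{x, y}], that is, to a hamiltonian [x, y]-path; see [close_path]. *)
Record stuck (V : finType) (H : {set {set V}}) (x y : V) (m r : nat) : Prop := Stuck {
  stuck_card : #|V| = m.+1;
  stuck_uniform : uniform r H;
  stuck_r : 2 < r;
  stuck_open : forall S, valid H x y m S -> forall e, e \in fr H m S ->
    vbeg S \in e -> vend m S \in e -> False }.

Section Stuck.

Variables (V : finType) (H : {set {set V}}) (x y : V) (m r : nat).
Implicit Types (F : {set {set V}}) (e f : {set V}) (u v : V) (i j l : nat).

Hypothesis W : stuck H x y m r.

Local Notation cardV := (stuck_card W).
Local Notation uH := (stuck_uniform W).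
Local Notation r_gt2 := (stuck_r W).
Local Notation no_closing := (stuck_open W).

Local Notation valid := (valid H x y m).
Local Notation fr := (fr H m).
Local Notation vend := (vend m).
Local Notation labs := (labs m).
Local Notation JL := (JL H m).
Local Notation JR := (JR H m).
Local Notation rot := (rot m).
Local Notation mir := (mir m).
Local Notation nL S := (nb (fr S) (vend S)).
Local Notation nR S := (nb (fr S) (vbeg S)).

Set Default Proof Using "All".

(** * Degrees and free neighbourhoods in one state *)

Section Counting.

Variable S : state V.
Hypothesis vS : valid S.

Lemma vx_eq i j : i <= m -> j <= m -> (vx S i == vx S j) = (i == j).
Proof.
move=> im jm; apply/eqP/eqP => [|-> //].
exact: vx_inj vS _ _ im jm.
Qed.

Lemma vx_onto u : exists2 i, i <= m & vx S i = u.
Proof.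
have inj : injective (fun i : 'I_m.+1 => vx S i).
  move=> i j /= /(vx_inj vS); have := ltn_ord i; have := ltn_ord j.
  by rewrite !ltnS => ? ? /(_ _ _)-E; apply: val_inj; apply: E.
have uc : u \in codom (fun i : 'I_m.+1 => vx S i).
  by apply: inj_card_onto; rewrite // card_ord cardV.
by case/codomP: uc => i ->; exists i => //; have := ltn_ord i; rewrite ltnS.
Qed.

Lemma card_pos (A : {set V}) : vend S \notin A ->
  #|[set j : 'I_m | vx S j \in A]| = #|A|.
Proof.
move=> aA; rewrite -(card_in_imset (f := fun j : 'I_m => vx S j)).
  congr #|pred_of_set _|; apply/setP => u; apply/imsetP/idP => [[j]|uA].
    by rewrite inE => ? ->.
  have [i im iu] := vx_onto u; have im' : i < m.
    rewrite ltn_neqAle im andbT; apply: contraNneq aA => im'.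
    by rewrite /vend -im' iu.
  by exists (Ordinal im'); rewrite ?inE /= iu.
move=> i j _ _ /(vx_inj vS) E; apply: val_inj => /=; apply: E;
by apply: ltnW.
Qed.

Lemma card_pos1 (A : {set V}) : vbeg S \notin A ->
  #|[set j : 'I_m | vx S j.+1 \in A]| = #|A|.
Proof.
move=> aA; rewrite -(card_in_imset (f := fun j : 'I_m => vx S j.+1)).
  congr #|pred_of_set _|; apply/setP => u; apply/imsetP/idP => [[j]|uA].
    by rewrite inE => ? ->.
  have [[|i] im iu] := vx_onto u; first by rewrite /vbeg iu uA in aA.
  by exists (Ordinal im); rewrite ?inE /= iu.
move=> i j _ _ /(vx_inj vS) E; apply: val_inj => /=.
by have /(_ _ _)/eq_add_S := E; apply.
Qed.

Lemma card_JL : #|JL S| = #|nb (fr S) (vend S)|.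
Proof. by rewrite -card_pos // nb_irr. Qed.

Lemma card_JR : #|JR S| = #|nb (fr S) (vbeg S)|.
Proof. by rewrite -card_pos1 // nb_irr. Qed.

Lemma lb_card j : j < m -> j != sp S -> #|lb S j| = r.
Proof. by move=> jm js; apply: uH; apply: lb_edge vS _ jm js. Qed.

Lemma sp_notin : lb S (sp S) \notin H.
Proof.
apply: contraL r_gt2 => /uH; rewrite (lb_sp vS) cards2 => <-.
by case: eqP.
Qed.

Lemma deg_split v : degree H v = #|fe (fr S) v| + #|labs S v|.
Proof.
have -> : #|labs S v| = #|(fun j : 'I_m => lb S j) @: labs S v|.
  rewrite card_in_imset // => i j _ _ /(lb_inj vS) E; apply: val_inj.
  by apply: E.
rewrite /degree -cardsUI; have -> : fe (fr S) v :&: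
    [set lb S j | j : 'I_m in labs S v] = set0.
  apply/setP => e; rewrite in_setI in_fe in_set0; apply/negP => /andP[/andP[eF _]].
  by case/imsetP => j _ E; have := fr_lb eF (ltn_ord j); rewrite E eqxx.
rewrite cards0 addn0; congr #|pred_of_set _|; apply/setP => e.
apply/idP/setUP; last first.
  case; first by rewrite in_fe inE => /andP[/fr_edge-> ->].
  case/imsetP => j; rewrite in_labs inE => /andP[js vj] ->.
  by rewrite vj andbT; apply: lb_edge vS _ (ltn_ord j) js.
rewrite inE => /andP[eH ve].
case: (boolP (e \in fr S)) => eF; first by left; rewrite in_fe eF.
right; move: eF; rewrite inE eH /= => /forallPn[j]; rewrite negbK => /eqP E.
apply/imsetP; exists j => //; rewrite inE E ve andbT.
by apply: contraNneq sp_notin => <-; rewrite E.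
Qed.

Lemma fe_bound F v : F \subset H -> #|fe F v| <= 'C(#|nb F v|, r.-1).
Proof.
move=> FH; rewrite -cards_draws -(card_in_imset (f := fun e => e :\ v) (D := fe F v)).
  apply: subset_leq_card; apply/subsetP => A /imsetP[e].
  rewrite in_fe => /andP[eF ve] ->; rewrite inE nb_sub //=.
  have := cardsD1 v e; rewrite ve (uH (subsetP FH _ eF)) => ->.
  by rewrite eqxx.
move=> e f; rewrite !in_fe => /andP[_ ve] /andP[_ vf] E.
by rewrite -(setD1K ve) E setD1K.
Qed.

Lemma fr_sub : fr S \subset H.
Proof. by apply/subsetP => e /fr_edge. Qed.

Lemma fr_card e : e \in fr S -> #|e| = r.
Proof. by move=> /fr_edge/uH. Qed.

Lemma nb_ge e v : e \in fr S -> v \in e -> r.-1 <= #|nb (fr S) v|.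
Proof.
move=> eF ve; have := cardsD1 v e; rewrite ve (fr_card eF) => ->.
by rewrite add1n /=; apply/subset_leq_card/nb_sub.
Qed.

Lemma nb_gt0 v : 0 < #|nb (fr S) v| -> r.-1 <= #|nb (fr S) v|.
Proof. by case/card_gt0P => u /nbP[_ [e eF [_ ve]]]; apply: nb_ge eF ve. Qed.

Lemma nb0_fe v : #|nb (fr S) v| = 0 -> fe (fr S) v = set0.
Proof.
move=> n0; apply/setP => e; rewrite in_fe in_set0; apply/negP => /andP[eF ve].
by have := nb_ge eF ve; rewrite n0; have := r_gt2; lia.
Qed.

Lemma nb_fe e v : e \in fr S -> v \in e -> #|nb (fr S) v| = r.-1 ->
  nb (fr S) v = e :\ v.
Proof.
move=> eF ve n1; apply/esym/eqP; rewrite eqEcard nb_sub //= n1.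
by have := cardsD1 v e; rewrite ve (fr_card eF) => ->.
Qed.

Lemma fe_uniq e f v : #|nb (fr S) v| < r -> e \in fr S -> f \in fr S ->
  v \in e -> v \in f -> e = f.
Proof.
move=> n1 eF fF ve vf; have n1' : #|nb (fr S) v| = r.-1.
  by have := nb_ge eF ve; have := r_gt2; lia.
by rewrite -(setD1K ve) -(nb_fe eF ve n1') (nb_fe fF vf n1') setD1K.
Qed.

Lemma fe_card1 v : #|nb (fr S) v| < r -> #|fe (fr S) v| <= 1.
Proof.
move=> n1; apply/card_le1_eqP => e f; rewrite !in_fe.
by move=> /andP[eF ve] /andP[fF vf]; apply: (fe_uniq n1).
Qed.

End Counting.

Lemma card_labs_mir S v : valid S -> #|labs (mir S) v| = #|labs S v|.
Proof.
move=> vS; have vM := mir_valid vS.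
by have := deg_split vM v; rewrite (deg_split vS v) mir_fr => /addnI.
Qed.

(** * Positions that exclude each other *)

Section Crossings.

Variable S : state V.
Hypothesis vS : valid S.

Lemma end_notin_nb : vend S \notin nb (fr S) (vbeg S).
Proof. by apply/negP => /nbP[_ [e eF [ae be]]]; apply: no_closing vS _ eF be ae. Qed.

Lemma beg_notin_nb : vbeg S \notin nb (fr S) (vend S).
Proof. by rewrite nb_sym end_notin_nb. Qed.

(** In these names L and R stand for a free neighbour of the last and of the first vertex, U for a
    label (a used edge) through an end. Here the rotation at [j] with a free edge frees [lb S j],
    which contains both ends of the new state. *)
Lemma crossLU j : j < m -> j != sp S -> vx S j \in nb (fr S) (vend S) ->
  vbeg S \in lb S j -> False.
Proof.
move=> jm js /nbP[_ [e eF [je ae]]] bj.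
have vR := rot_valid vS jm js (introT orP (or_introl eF)) je ae.
apply: (no_closing vR (e := lb S j)).
- by rewrite (rot_fr vS) // !inE eqxx.
- exact: bj.
- by rewrite rot_vend //; case/andP: (lb_vx vS jm).
Qed.

(** The rotation at [j] through its own label makes [vx S j.+1] the last vertex and changes no free
    edge, so the edge that joins this vertex to the first one closes the path. *)
Lemma crossUR j : j < m -> j != sp S -> vend S \in lb S j ->
  vx S j.+1 \in nb (fr S) (vbeg S) -> False.
Proof.
move=> jm js aj /nbP[_ [e eF [je be]]].
have [jj _] := andP (lb_vx vS jm).
have vR := rot_valid vS jm js (introT orP (or_intror (eqxx _))) jj aj.
apply: (no_closing vR (e := e)) => //; first by rewrite rot_fr_lb.
by rewrite rot_vend.
Qed.

Lemma crossLR j : j < m -> j != sp S -> vx S j \in nb (fr S) (vend S) ->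
  vx S j.+1 \in nb (fr S) (vbeg S) -> False.
Proof.
move=> jm js /nbP[_ [e eF [je ae]]] /nbP[_ [f fF [jf bf]]].
have vR := rot_valid vS jm js (introT orP (or_introl eF)) je ae.
apply: (no_closing vR (e := f)) => //; last by rewrite rot_vend.
(* [f] is still free after the rotation: if it were [e], it would contain both ends of [S]. *)
rewrite (rot_fr vS) // in_setU1 in_setD1 fF andbT; apply/orP; right.
apply/eqP => fe; apply: no_closing vS _ eF _ ae; by rewrite -fe.
Qed.

Lemma JLR_sub (i : 'I_m) : i \in JL S -> i \in JR S -> i = sp S :> nat.
Proof.
rewrite in_JL in_JR => iL iR; apply/eqP/negPn/negP => js.
by apply: (crossLR (ltn_ord i) js iL iR).
Qed.

End Crossings.

Lemma card_H_le S : valid S -> #|H| <= #|fr S| + m.-1.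
Proof.
move=> vS; have sm := sp_lt vS.
have <- : #|[set lb S j | j : 'I_m in ~: [set Ordinal sm]]| = m.-1.
  rewrite card_in_imset; last first.
    by move=> i j _ _ /(lb_inj vS) E; apply: val_inj; apply: E.
  by have := cardsC1 (Ordinal sm); rewrite card_ord.
rewrite -cardsUI; apply: leq_trans (leq_addr _ _).
apply/subset_leq_card/subsetP => e eH; rewrite in_setU.
case: (boolP (e \in fr S)) => //=; rewrite inE eH /= => /forallPn[j].
rewrite negbK => /eqP E; apply/imsetP; exists j => //.
rewrite in_setC in_set1 -val_eqE /=.
by apply: contraNneq (sp_notin vS) => <-; rewrite E.
Qed.

Lemma end_neq_beg S : valid S -> vend S != vbeg S.
Proof.
move=> vS; rewrite /vend /vbeg (vx_eq vS) //.
by have := sp_lt vS; lia.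
Qed.

Lemma sum_nb S : valid S -> #|nL S| + #|nR S| <= m.+1.
Proof.
move=> vS; rewrite -(card_JL vS) -(card_JR vS) -cardsUI.
have IJ : #|JL S :&: JR S| <= 1.
  apply/card_le1_eqP => i j; rewrite !in_setI.
  move=> /andP[iL iR] /andP[jL jR]; apply: val_inj => /=.
  by rewrite (JLR_sub vS iL iR) (JLR_sub vS jL jR).
by have := max_card (JL S :|: JR S); rewrite card_ord; lia.
Qed.

Lemma labs_end S : valid S -> #|labs S (vend S)| + #|nR S| <= m.
Proof.
move=> vS; rewrite -(card_JR vS) -cardsUI.
have -> : labs S (vend S) :&: JR S = set0.
  apply/setP => i; rewrite in_setI in_labs in_JR in_set0; apply/negP.
  by case/andP => /andP[js aj]; exact: (crossUR vS (ltn_ord i) js aj).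
by have := max_card (labs S (vend S) :|: JR S); rewrite card_ord cards0; lia.
Qed.

Lemma labs_beg S : valid S -> #|labs S (vbeg S)| + #|nL S| <= m.
Proof.
move=> vS; have := labs_end (mir_valid vS).
by rewrite (card_labs_mir _ vS) // mir_vend mir_vbeg mir_fr.
Qed.

Lemma rotF S l e : valid S -> l < m -> l != sp S -> e \in fr S ->
  vx S l \in e -> vend S \in e ->
  [/\ valid (rot S l e), fr (rot S l e) = lb S l |: (fr S :\ e) &
      vend (rot S l e) = vx S l.+1].
Proof.
move=> vS lm ls eF le ae; split; last exact: rot_vend.
  by apply: (rot_valid vS) => //; rewrite eF.
exact: (rot_fr vS lm eF ls).
Qed.

Lemma rotU S l : valid S -> l < m -> l != sp S -> vend S \in lb S l ->
  [/\ valid (rot S l (lb S l)), fr (rot S l (lb S l)) = fr S &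
      vend (rot S l (lb S l)) = vx S l.+1].
Proof.
move=> vS lm ls al; have /andP[ll l1l] := lb_vx vS lm.
split; [|exact: rot_fr_lb|exact: rot_vend].
by apply: (rot_valid vS) => //; rewrite eqxx orbT.
Qed.

(** Locates a label after a rotation. To the right of [l] the path is traversed backwards, which
    swaps the two vertices that a label links. *)
Lemma rot_pos S l e j : valid S -> l < m -> l != sp S -> j < m -> j != l ->
  exists j', [/\ j' < m, lb (rot S l e) j' = lb S j,
    (j' == sp (rot S l e)) = (j == sp S) &
    if j < l then vx (rot S l e) j' = vx S j /\ vx (rot S l e) j'.+1 = vx S j.+1
    else vx (rot S l e) j' = vx S j.+1 /\ vx (rot S l e) j'.+1 = vx S j].
Proof.
move=> vS lm ls jm jl; have sm := sp_lt vS.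
case: (ltnP j l) => jl'.
  exists j; rewrite /= jl' (ltnW jl'); split=> //.
  by case: (ltnP (sp S) l) => // sl; apply/eqP/eqP; lia.
have {}jl' : l < j by lia.
exists (m + l - j); split=> /=.
- lia.
- rewrite ltnNge (_ : l <= m + l - j) /=; last lia.
  rewrite (negPf (_ : m + l - j != l)); last lia.
  by congr (lb S _); lia.
- by case: (ltnP (sp S) l) => sl; apply/eqP/eqP; lia.
- rewrite leqNgt (_ : l < m + l - j) /=; last lia.
  rewrite leqNgt (_ : l < (m + l - j).+1) /=; last lia.
  by split; congr (vx S _); lia.
Qed.

(** The rotation that moves the first vertex and reverses the path up to position [l]; written as a
    conjugate of [rot], it inherits its validity from [rot_valid]. *)
Definition rotb S l e := mir (rot (mir S) (m.-1 - l) e).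

Lemma rotb_spec S l e : valid S -> l < m -> l != sp S ->
  (e \in fr S) || (e == lb S l) -> vx S l.+1 \in e -> vbeg S \in e ->
  [/\ valid (rotb S l e), vbeg (rotb S l e) = vx S l,
      vend (rotb S l e) = vend S,
      (e \in fr S -> fr (rotb S l e) = lb S l |: (fr S :\ e)) &
      (e = lb S l -> fr (rotb S l e) = fr S)].
Proof.
move=> vS lm ls eF l1e be; have vM := mir_valid vS.
have sm := sp_lt vS.
have l'm : m.-1 - l < m by lia.
have ls' : m.-1 - l != sp (mir S) by rewrite /=; lia.
have E : lb (mir S) (m.-1 - l) = lb S l by rewrite /=; congr (lb S _); lia.
have E' : vx (mir S) (m.-1 - l) = vx S l.+1 by rewrite /=; congr (vx S _); lia.
have vR : valid (rot (mir S) (m.-1 - l) e).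
  by apply: rot_valid => //; rewrite ?E ?E' ?mir_vend ?mir_fr.
split.
- exact: mir_valid.
- rewrite mir_vbeg rot_vend //=; congr (vx S _); lia.
- by rewrite mir_vend -[LHS]/(vbeg (mir S)) mir_vbeg.
- by move=> eF'; rewrite mir_fr (rot_fr vM) ?mir_fr ?E.
- by move=> eE; rewrite mir_fr eE -E rot_fr_lb // mir_fr.
Qed.

Lemma rotb_pos S l e j : valid S -> l < m -> l != sp S -> j < m -> j < l ->
  let S' := rotb S l e in
  [/\ vx S' (l.-1 - j) = vx S j.+1, vx S' (l.-1 - j).+1 = vx S j,
      lb S' (l.-1 - j) = lb S j & (l.-1 - j == sp S') = (j == sp S)].
Proof.
move=> vS lm ls jm jl; have sm := sp_lt vS; rewrite /=; split.
- rewrite leqNgt (_ : m.-1 - l < m - (l.-1 - j)) /=; last lia.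
  congr (vx S _); lia.
- rewrite leqNgt (_ : m.-1 - l < m - (l.-1 - j).+1) /=; last lia.
  congr (vx S _); lia.
- rewrite ltnNge (_ : m.-1 - l <= m.-1 - (l.-1 - j)) /=; last lia.
  rewrite (negPf (_ : m.-1 - (l.-1 - j) != m.-1 - l)); last lia.
  congr (lb S _); lia.
- by case: ltnP => sl; apply/eqP/eqP; lia.
Qed.

Lemma nb_exch F e f v : v \notin e -> v \notin f ->
  nb (f |: (F :\ e)) v = nb F v.
Proof.
move=> ve vf; apply/setP => u; apply/nbP/nbP => -[uv [g gF [ug vg]]]; split=> //.
  exists g => //; move: gF; rewrite in_setU1 in_setD1.
  by case/orP => [/eqP gf|/andP[]//]; rewrite -gf vg in vf.
exists g => //; rewrite in_setU1 in_setD1 gF andbT; apply/orP; right.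
by apply: contraNneq ve => <-.
Qed.

Lemma swpF S l e : valid S -> l < m -> l != sp S -> e \in fr S ->
  vx S l \in e -> vx S l.+1 \in e ->
  valid (swp S l e) /\ fr (swp S l e) = lb S l |: (fr S :\ e).
Proof.
move=> vS lm ls eF le l1e; split; first exact: swp_valid.
exact: (swp_fr vS lm eF ls).
Qed.

(** Exchanging [lb S l] for [e] frees a label through the last vertex, so [vx S j] becomes its free
    neighbour, while the first vertex loses no free edge because it avoids [e]. Then [crossLR]
    applies at [j]. *)
Lemma swap_end S l e j : valid S -> l < m -> l != sp S -> e \in fr S ->
  vx S l \in e -> vx S l.+1 \in e -> vend S \in lb S l -> vbeg S \notin e ->
  j < m -> j != sp S -> vx S j \in lb S l -> vx S j.+1 \in nR S -> False.
Proof.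
move=> vS lm ls eF le l1e al be jm js jl /nbP[bj [f fF [j1f bf]]].
have [vS' frS'] := swpF vS lm ls eF le l1e.
apply: (crossLR vS' jm js).
  apply: (mem_nb (e := lb S l)) => //; first by rewrite frS' setU11.
  by rewrite /vend /= (vx_eq vS) //; lia.
apply: (mem_nb (e := f)) => //.
by rewrite frS' in_setU1 in_setD1 fF (contraNneq _ be) ?orbT // => <-.
Qed.

Lemma swap_beg S l e j : valid S -> l < m -> l != sp S -> e \in fr S ->
  vx S l \in e -> vx S l.+1 \in e -> vbeg S \in lb S l -> vend S \notin e ->
  j < m -> j != sp S -> vx S j.+1 \in lb S l -> vx S j \in nL S -> False.
Proof.
move=> vS lm ls eF le l1e al be jm js jl /nbP[bj [f fF [j1f bf]]].
have [vS' frS'] := swpF vS lm ls eF le l1e.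
apply: (crossLR vS' jm js).
  apply: (mem_nb (e := f)) => //.
  by rewrite frS' in_setU1 in_setD1 fF (contraNneq _ be) ?orbT // => <-.
apply: (mem_nb (e := lb S l)) => //; first by rewrite frS' setU11.
by rewrite /vbeg /= (vx_eq vS) //; lia.
Qed.

Lemma nLE S e : valid S -> #|nL S| < r -> e \in fr S -> vend S \in e ->
  nL S = e :\ vend S.
Proof.
move=> vS n1 eF ae; apply: (nb_fe vS) => //.
by have := nb_ge vS eF ae; lia.
Qed.

Lemma nRE S e : valid S -> #|nR S| < r -> e \in fr S -> vbeg S \in e ->
  nR S = e :\ vbeg S.
Proof.
move=> vS n1 eF ae; apply: (nb_fe vS) => //.
by have := nb_ge vS eF ae; lia.
Qed.

Lemma vx_onto_end S u : valid S -> u != vend S -> exists2 j, j < m & vx S j = u.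
Proof.
move=> vS ua; have [j jm ju] := vx_onto vS u.
exists j => //; rewrite ltn_neqAle jm andbT; apply: contraNneq ua => E.
by rewrite -ju E.
Qed.

Lemma vx_onto_beg S u : valid S -> u != vbeg S -> exists2 j, j < m & vx S j.+1 = u.
Proof.
move=> vS ub; have [[|j] jm ju] := vx_onto vS u; last by exists j.
by rewrite -ju eqxx in ub.
Qed.

Lemma edge_eqD1 e f v : e \in H -> f \in H -> v \in f ->
  e :\ v \subset f :\ v -> e = f.
Proof.
move=> eH fH vf ef; apply/eqP; rewrite eqEcard (uH eH) (uH fH) leqnn andbT.
apply/subsetP => u ue; have [-> //|uv] := eqVneq u v.
by have /subsetP/(_ u) := ef; rewrite !in_setD1 uv ue => /(_ isT).
Qed.

(** * Large uniformity *)

(** Two sets of positions that share at most [sp S] can have [m.+1] elements in total only if they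
    cover all [m] positions and do share [sp S]. *)
Lemma nb_tight S : valid S -> #|nL S| + #|nR S| = m.+1 ->
  [/\ forall j, j < m -> vx S j \notin nL S -> vx S j.+1 \in nR S,
      vx S (sp S) \in nL S & vx S (sp S).+1 \in nR S].
Proof.
move=> vS; rewrite -(card_JL vS) -(card_JR vS) -cardsUI => E.
have [i iL iR] : exists2 i, i \in JL S & i \in JR S.
  have /card_gt0P[i] : 0 < #|JL S :&: JR S|.
    by have := max_card (JL S :|: JR S); rewrite card_ord; lia.
  by rewrite in_setI => /andP[]; exists i.
have si := JLR_sub vS iL iR.
have IJ : #|JL S :&: JR S| <= 1.
  apply/card_le1_eqP => j k; rewrite !in_setI => /andP[jL jR] /andP[kL kR].
  by apply: val_inj; rewrite /= (JLR_sub vS jL jR) (JLR_sub vS kL kR).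
have UT : JL S :|: JR S = setT.
  by apply/eqP; rewrite eqEcard subsetT cardsT card_ord; lia.
split.
- move=> j jm jL; have : Ordinal jm \in JL S :|: JR S by rewrite UT.
  by rewrite in_setU in_JL in_JR /= (negPf jL).
- by move: iL; rewrite in_JL si.
- by move: iR; rewrite in_JR si.
Qed.

(* Swapping the last label for a free edge [e] at the last vertex frees that label, so
   its vertices become free neighbours of the last vertex. By [nb_tight] they already were,
   hence they lie in [e]. *)
Lemma tight_false S : valid S -> #|nL S| + #|nR S| = m.+1 -> #|nL S| < r -> False.
Proof.
move=> vS E pr; have [cov sL sR] := nb_tight vS E.
have sm := sp_lt vS; have lm : m.-1 < m by lia.
have l1 : m.-1.+1 = m by lia.
have aR : vend S \notin nR S := end_notin_nb vS.
have ls : m.-1 != sp S.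
  by apply: contraNneq aR => ls; move: sR; rewrite -ls l1.
have lL : vx S m.-1 \in nL S.
  by apply: contraNT aR => /(cov _ lm); rewrite l1.
have [_ [e eF [le ae]]] := nbP _ _ _ lL.
have al : vend S \in lb S m.-1 by have := lb_vx vS lm; rewrite l1 => /andP[].
have be : vbeg S \notin e by apply/negP => be; exact: (no_closing vS eF be ae).
have /eqP := fr_lb eF lm; apply.
apply: (edge_eqD1 (lb_edge vS lm ls) (fr_edge eF) ae).
rewrite -(nLE vS pr eF ae); apply/subsetP => u; rewrite in_setD1 => /andP[ua ul].
have [j jm ju] := vx_onto_end vS ua; move: ul; rewrite -ju => jl.
have [-> //|js] := eqVneq j (sp S).
apply: contraT => /(cov _ jm) jR; exfalso.
apply: (swap_end vS lm ls eF le _ al be jm js jl jR).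
by rewrite l1.
Qed.

Lemma tight_false_beg S : valid S -> #|nL S| + #|nR S| = m.+1 -> #|nR S| < r ->
  False.
Proof.
move=> vS E qr; apply: (tight_false (mir_valid vS));
by rewrite mir_vend ?mir_vbeg mir_fr // addnC.
Qed.

(** As [e] and [f] differ, both exchanges can be made in turn; the two freed labels then bring [o]
    into the situation that [crossLR] forbids. *)
Lemma double_swap S l e l' f o : valid S -> l < m -> l != sp S -> l' < m ->
  l' != sp S -> l' != l -> e \in fr S -> f \in fr S -> e != f ->
  vx S l \in e -> vx S l.+1 \in e -> vx S l' \in f -> vx S l'.+1 \in f ->
  o < m -> o != sp S -> vend S \in lb S l -> vx S o \in lb S l ->
  vbeg S \in lb S l' -> vx S o.+1 \in lb S l' -> False.
Proof.
move=> vS lm ls lm' ls' ll' eF fF ef le l1e lf l1f om os al ol bl o1l.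
have [vS1 frS1] := swpF vS lm ls eF le l1e.
have fF1 : f \in fr (swp S l e).
  by rewrite frS1 in_setU1 in_setD1 fF andbT [f == e]eq_sym ef orbT.
have [vS2 frS2] := swpF vS1 lm' ls' fF1 lf l1f.
have lE : lb (swp S l e) l' = lb S l' by rewrite /= (negPf ll').
have F1 : lb S l \in fr (swp (swp S l e) l' f).
  rewrite frS2 in_setU1 in_setD1 frS1 setU11 andbT; apply/orP; right.
  exact: (fr_lb fF lm).
have F2 : lb S l' \in fr (swp (swp S l e) l' f) by rewrite frS2 lE setU11.
have os2 : o != sp (swp (swp S l e) l' f) by [].
have sm := sp_lt vS.
have oa : vx S o != vend S by rewrite (vx_eq vS) // 1?ltnW // ltn_eqF.
have ob : vx S o.+1 != vbeg S by rewrite (vx_eq vS).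
apply: (crossLR vS2 om os2).
  exact: (mem_nb F1 ol al oa).
exact: (mem_nb F2 o1l bl ob).
Qed.

(** * Two free neighbourhoods of size r - 1 with sum m *)

Section SumM.

Variable S : state V.
Hypotheses (vS : valid S) (pE : #|nL S| = r.-1) (qE : #|nR S| = r.-1).
Hypothesis mE : #|nL S| + #|nR S| = m.

(** [JL S] and [JR S] partition the positions. As in [tight_false], the label next to an end is
    forced to equal a free edge. If [sp S] is not 0, this is done at the first vertex, where the
    position [sp S] is harmless since it belongs to [JR S]; otherwise at the last vertex, where
    [sp S] is the position of the first vertex and is excluded by [crossLU]. *)
Lemma sum_m_false_R : vx S (sp S) \notin nL S -> vx S (sp S).+1 \in nR S -> False.
Proof.
move=> sL sR; have sm := sp_lt vS.
have I0 : JL S :&: JR S = set0.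
  apply/setP => i; rewrite in_setI in_set0; apply/negP => /andP[iL iR].
  by move: (iL); rewrite in_JL (JLR_sub vS iL iR) (negPf sL).
have UT : JL S :|: JR S = setT.
  apply/eqP; rewrite eqEcard subsetT cardsT card_ord; move: (cardsUI (JL S) (JR S)).
  by rewrite I0 cards0 addn0 (card_JL vS) (card_JR vS) mE => ->; rewrite leqnn.
have cov j : j < m -> (vx S j \in nL S) || (vx S j.+1 \in nR S).
  by move=> jm; have := in_setT (Ordinal jm); rewrite -UT in_setU in_JL in_JR.
have bL := beg_notin_nb vS; have aR := end_notin_nb vS.
have pr : #|nL S| < r by lia.
have qr : #|nR S| < r by lia.
have [s0|s0] := eqVneq (sp S) 0; last first.
  have m0 : 0 < m by lia.
  have := cov 0 m0; rewrite -[vx S 0]/(vbeg S) (negPf bL) /= => R1.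
  have [_ [e eF [e1 eb]]] := nbP _ _ _ R1.
  have ae : vend S \notin e by apply/negP => ae; exact: (no_closing vS eF eb ae).
  have /andP[b0 _] := lb_vx vS m0; rewrite eq_sym in s0.
  have /eqP := fr_lb eF m0; apply.
  apply: (edge_eqD1 (lb_edge vS m0 s0) (fr_edge eF) eb).
  rewrite -(nRE vS qr eF eb); apply/subsetP => u; rewrite in_setD1 => /andP[ub ul].
  have [j jm ju] := vx_onto_beg vS ub; move: ul; rewrite -ju => jl.
  have [-> //|js] := eqVneq j (sp S).
  have /orP[jL|//] := cov j jm; exfalso.
  exact: (swap_beg vS m0 s0 eF eb e1 b0 ae jm js jl jL).
have lm : m.-1 < m by lia.
have l1 : m.-1.+1 = m by lia.
have ls : m.-1 != sp S by rewrite s0; apply/eqP; lia.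
have := cov _ lm; rewrite l1 -[vx S m]/(vend S) (negPf aR) orbF => lL.
have [_ [e eF [le ae]]] := nbP _ _ _ lL.
have al : vend S \in lb S m.-1 by have := lb_vx vS lm; rewrite l1 => /andP[].
have be : vbeg S \notin e by apply/negP => be; exact: (no_closing vS eF be ae).
have /eqP := fr_lb eF lm; apply.
apply: (edge_eqD1 (lb_edge vS lm ls) (fr_edge eF) ae).
rewrite -(nLE vS pr eF ae); apply/subsetP => u; rewrite in_setD1 => /andP[ua ul].
have [j jm ju] := vx_onto_end vS ua; move: ul; rewrite -ju => jl.
have [js|js] := eqVneq j (sp S).
  exfalso; apply: (crossLU vS lm ls lL).
  by move: jl; rewrite js s0.
have /orP[//|jR] := cov j jm; exfalso.
apply: (swap_end vS lm ls eF le _ al be jm js jl jR).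
by rewrite l1.
Qed.

(** The overlap at [sp S] leaves exactly one position [o] uncovered, so the labels next to the ends
    can differ from free edges only by reaching the vertices at [o]. If [o] is the first or the last
    position, a label freed at the other end contains both ends; otherwise [double_swap] applies to
    the two outermost labels. *)
Lemma sum_m_false_LR : vx S (sp S) \in nL S -> vx S (sp S).+1 \in nR S -> False.
Proof.
move=> sL sR; have sm := sp_lt vS; set s := Ordinal sm.
have IJ : JL S :&: JR S = [set s].
  apply/setP => i; rewrite in_setI in_set1; apply/andP/eqP => [[iL iR]|->].
    by apply: val_inj; exact: (JLR_sub vS iL iR).
  by rewrite in_JL in_JR.
have := cardsUI (JL S) (JR S).
rewrite (card_JL vS) (card_JR vS) mE IJ cards1 => cU.
have /cards1P[o oE] : #|~: (JL S :|: JR S)| == 1.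
  by have := cardsC (JL S :|: JR S); rewrite card_ord; lia.
have cov j (jm : j < m) : j != o -> (vx S j \in nL S) || (vx S j.+1 \in nR S).
  move=> jo; have : Ordinal jm \notin ~: (JL S :|: JR S).
    by rewrite oE in_set1 -val_eqE.
  by rewrite in_setC negbK in_setU in_JL in_JR.
have om := ltn_ord o.
have [oL oR] : vx S o \notin nL S /\ vx S o.+1 \notin nR S.
  have : o \in ~: (JL S :|: JR S) by rewrite oE in_set1.
  by rewrite in_setC in_setU in_JL in_JR negb_or => /andP.
have os : nat_of_ord o != sp S by apply: contraNneq oL => ->.
have bL := beg_notin_nb vS; have aR := end_notin_nb vS.
have pr : #|nL S| < r by lia.
have qr : #|nR S| < r by lia.
have m0 : 0 < m by lia.
have s0 : 0 != sp S by apply: contraNneq bL => E; rewrite -E in sL.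
have l0 : 0 != m.-1 by apply/eqP; have := r_gt2; lia.
have lm : m.-1 < m by lia.
have l1 : m.-1.+1 = m by lia.
have ls : m.-1 != sp S.
  by apply: contraNneq aR => E; rewrite -E l1 in sR.
have al : vend S \in lb S m.-1 by have := lb_vx vS lm; rewrite l1 => /andP[].
have /andP[b0 _] := lb_vx vS m0; rewrite -[vx S 0]/(vbeg S) in b0.
(* Otherwise the argument of [tight_false] gives [lb S 0 = e]. *)
have Rswap : 0 != o -> exists2 e, e \in fr S &
    [/\ vbeg S \in e, vx S 1 \in e & vx S o.+1 \in lb S 0].
  move=> o0; have := cov 0 m0 o0; rewrite -[vx S 0]/(vbeg S) (negPf bL) /= => R1.
  have [_ [e eF [e1 eb]]] := nbP _ _ _ R1; exists e => //; split=> //.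
  have ae : vend S \notin e by apply/negP => ae; exact: (no_closing vS eF eb ae).
  apply: contraT => ol; exfalso; have /eqP := fr_lb eF m0; apply.
  apply: (edge_eqD1 (lb_edge vS m0 s0) (fr_edge eF) eb).
  rewrite -(nRE vS qr eF eb); apply/subsetP => u; rewrite in_setD1 => /andP[ub ul].
  have [j jm ju] := vx_onto_beg vS ub; move: ul; rewrite -ju => jl.
  have [-> //|js] := eqVneq j (sp S).
  have jo : j != o by apply: contraNneq ol => <-.
  have /orP[jL|//] := cov j jm jo; exfalso.
  exact: (swap_beg vS m0 s0 eF eb e1 b0 ae jm js jl jL).
have Lswap : m.-1 != o -> exists2 e, e \in fr S &
    [/\ vend S \in e, vx S m.-1 \in e & vx S o \in lb S m.-1].
  move=> ol; have := cov _ lm ol.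
  rewrite l1 -[vx S m]/(vend S) (negPf aR) orbF => lL.
  have [_ [e eF [le ae]]] := nbP _ _ _ lL; exists e => //; split=> //.
  have be : vbeg S \notin e by apply/negP => be; exact: (no_closing vS eF be ae).
  apply: contraT => oN; exfalso; have /eqP := fr_lb eF lm; apply.
  apply: (edge_eqD1 (lb_edge vS lm ls) (fr_edge eF) ae).
  rewrite -(nLE vS pr eF ae); apply/subsetP => u; rewrite in_setD1 => /andP[ua ul].
  have [j jm ju] := vx_onto_end vS ua; move: ul; rewrite -ju => jl.
  have [-> //|js] := eqVneq j (sp S).
  have jo : j != o by apply: contraNneq oN => <-.
  have /orP[//|jR] := cov j jm jo; exfalso.
  apply: (swap_end vS lm ls eF le _ al be jm js jl jR).
  by rewrite l1.
have [ol|/Lswap[e eF [ae le oe]]] := eqVneq m.-1 o.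
  have /Rswap[e eF [eb e1 oe]] : 0 != o by rewrite -ol; apply/eqP; lia.
  have [vS' frS'] := swpF vS m0 s0 eF eb e1.
  apply: (no_closing vS' (e := lb S 0)); rewrite ?frS' ?setU11 //.
  by rewrite /vend /= -l1 ol.
have le1 : vx S m.-1.+1 \in e by rewrite l1.
have [vS1 frS1] := swpF vS lm ls eF le le1.
have [o0|/Rswap[f fF [bf f1 of_]]] := eqVneq 0 o.
  apply: (no_closing vS1 (e := lb S m.-1)); rewrite ?frS1 ?setU11 //.
  by rewrite /vbeg /= o0.
have be : vbeg S \notin e by apply/negP => be; exact: (no_closing vS eF be ae).
have ef : e != f by apply: contraNneq be => ->.
exact: (double_swap vS lm ls m0 s0 l0 eF fF ef le le1 bf f1 om os al oe b0 of_).
Qed.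

End SumM.

Lemma sum_m_false S : valid S -> #|nL S| = r.-1 -> #|nR S| = r.-1 ->
  #|nL S| + #|nR S| = m -> False.
Proof.
move=> vS pE qE mE; have sm := sp_lt vS.
have [sL|sL] := boolP (vx S (sp S) \in nL S);
  have [sR|sR] := boolP (vx S (sp S).+1 \in nR S).
- exact: (sum_m_false_LR vS pE qE mE sL sR).
- have vM := mir_valid vS; apply: (sum_m_false_R vM); rewrite ?mir_vend ?mir_vbeg ?mir_fr //.
  + by rewrite addnC.
  + by rewrite /= (_ : m - (m.-1 - sp S) = (sp S).+1) //; lia.
  + by rewrite /= (_ : m - (m.-1 - sp S).+1 = sp S) //; lia.
- exact: (sum_m_false_R vS pE qE mE sL sR).
- have I0 : JL S :&: JR S = set0.
    apply/setP => i; rewrite in_setI in_set0; apply/negP => /andP[iL iR].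
    by move: (iL); rewrite in_JL (JLR_sub vS iL iR) (negPf sL).
  have := cardsUI (JL S) (JR S); rewrite I0 cards0 addn0.
  rewrite (card_JL vS) (card_JR vS) mE => cU.
  have UT : JL S :|: JR S = setT.
    by apply/eqP; rewrite eqEcard subsetT cardsT card_ord cU leqnn.
  have := in_setT (Ordinal sm).
  by rewrite -UT in_setU in_JL in_JR /= (negPf sL) (negPf sR).
Qed.

(** If no end lies in a free edge, every edge at the last vertex is a label, and rotating through it
    changes no free edge. One of the resulting last vertices lies in [f]: otherwise they, [f] and
    the first vertex would be more than [m.+1] vertices. *)
Lemma ex_end_in_free S : valid S -> fr S != set0 ->
  (forall v, m < degree H v + r) ->
  exists2 S', valid S' & 0 < #|nL S'| + #|nR S'|.
Proof.
move=> vS /set0Pn[f fF] dr; have fr_f : #|f| = r := fr_card vS fF.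
have [n0|n0] := posnP (#|nL S| + #|nR S|); last by exists S.
have a0 : #|nL S| = 0 by lia.
have fe0 := nb0_fe vS a0.
have bf : vbeg S \notin f.
  apply/negP => bf; have := nb_ge vS fF bf; have := r_gt2; lia.
pose T := [set vx S j.+1 | j : 'I_m in labs S (vend S)].
have cT : #|T| = degree H (vend S).
  rewrite (deg_split vS) fe0 cards0 add0n card_in_imset //.
  move=> i j _ _ /(vx_inj vS) E; apply: val_inj => /=.
  by have /(_ _ _)/eq_add_S := E; apply.
have [/exists_inP[u uT uf]|] := boolP [exists u in T, u \in f].
  case/imsetP: uT uf => j; rewrite in_labs => /andP[js aj] -> jf.
  have [vS' frS' eS'] := rotU vS (ltn_ord j) js aj.
  exists (rot S j (lb S j)) => //.
  have := nb_ge vS' (e := f) (v := vx S j.+1).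
  by rewrite frS' eS' => /(_ fF jf); have := r_gt2; lia.
rewrite negb_exists_in => /forall_inP Tf; exfalso.
have : #|vbeg S |: (T :|: f)| <= m.+1 by rewrite -cardV max_card.
rewrite cardsU1 in_setU (negPf bf) orbF.
have -> : vbeg S \notin T.
  apply/imsetP => -[j _ /(vx_inj vS) E]; have := ltn_ord j.
  by have := E isT => /(_ (ltn_ord j)).
have := cardsUI T f; have -> : T :&: f = set0.
  apply/setP => u; rewrite in_setI in_set0; apply/negP => /andP[uT].
  by apply/negP/Tf.
by rewrite cards0; have := dr (vend S); lia.
Qed.

(* A state in which the last vertex lies in no free edge while the first one lies
   in exactly one, [f]: the labels containing the last vertex are then exactly the
   ones whose right end avoids [f]. *)
Section OneFreeEdge.

Variable S : state V.
Hypotheses (vS : valid S) (a0 : #|nL S| = 0) (qE : #|nR S| = r.-1).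
Hypothesis n_le : m <= 2 * r.
Hypothesis degH : forall v, m.+1 <= degree H v + r.

Lemma one_free_labs j : j < m -> j != sp S -> vx S j.+1 \notin nR S ->
  vend S \in lb S j.
Proof.
move=> jm js jR; have := labs_end vS.
have := deg_split vS (vend S); rewrite (nb0_fe vS a0) cards0 add0n => dE.
have dg := degH (vend S); have r2 := r_gt2.
rewrite -(card_JR vS) => lJ.
have I0 : labs S (vend S) :&: JR S = set0.
  apply/setP => i; rewrite in_setI in_labs in_JR in_set0; apply/negP.
  by case/andP => /andP[js' aj]; exact: (crossUR vS (ltn_ord i) js' aj).
have UT : labs S (vend S) :|: JR S = setT.
  apply/eqP; rewrite eqEcard subsetT cardsT card_ord /=.
  have := cardsUI (labs S (vend S)) (JR S); rewrite I0 cards0 addn0 => ->.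
  by move: qE; rewrite -(card_JR vS); lia.
have := in_setT (Ordinal jm).
by rewrite -UT in_setU in_JR /= (negPf jR) orbF in_labs => /andP[].
Qed.

(** The labels through the last vertex and the positions of [JR S] already number at least [m], and
    [sp S] is never counted among the former. *)
Lemma one_free_sp : vx S (sp S).+1 \in nR S.
Proof.
have := labs_end vS; have sm := sp_lt vS.
have := deg_split vS (vend S); rewrite (nb0_fe vS a0) cards0 add0n => dE.
have dg := degH (vend S); have r2 := r_gt2.
rewrite -(card_JR vS) => lJ; apply: contraT => sR.
have : #|Ordinal sm |: (labs S (vend S) :|: JR S)| <= m.
  by rewrite -[leqRHS]card_ord max_card.
rewrite cardsU1 in_setU in_labs in_JR /= eqxx (negPf sR) /= add1n.
have I0 : labs S (vend S) :&: JR S = set0.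
  apply/setP => i; rewrite in_setI in_labs in_JR in_set0; apply/negP.
  by case/andP => /andP[js' aj]; exact: (crossUR vS (ltn_ord i) js' aj).
have := cardsUI (labs S (vend S)) (JR S); rewrite I0 cards0 addn0 => ->.
by move: qE; rewrite -(card_JR vS); lia.
Qed.

Lemma one_free_edge : exists2 f, f \in fr S &
  [/\ vbeg S \in f, vend S \notin f & nR S = f :\ vbeg S].
Proof.
have r2 := r_gt2; have /card_gt0P[u /nbP[_ [f fF [_ bf]]]] : 0 < #|nR S| by lia.
exists f => //; split=> //; last by apply: (nb_fe vS).
by apply/negP => af; apply: (no_closing vS fF bf af).
Qed.

(** If the label at [l] had a vertex [u] outside [f], the label before [u] would contain the last
    vertex, and a rotation through it would make [u] the last vertex. This contradicts [crossUR] at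
    the label of [l], in whichever direction it is traversed, as both vertices that it links lie in
    [f]. So this label is [f], which is free. *)
Lemma one_free_no_pair f l : f \in fr S -> vbeg S \in f -> nR S = f :\ vbeg S ->
  l < m -> l != sp S -> vx S l \in f -> vx S l.+1 \in f -> False.
Proof.
move=> fF bf nRf lm ls lf l1f; have /eqP := fr_lb fF lm; apply; apply/eqP.
rewrite eqEcard (lb_card vS lm ls) (fr_card vS fF) leqnn andbT.
apply/subsetP => u ul; apply: contraT => uf; exfalso.
have ub : u != vbeg S by apply: contraNneq uf => ->.
have [i im iu] := vx_onto_beg vS ub.
have iR : vx S i.+1 \notin nR S by rewrite iu nRf in_setD1 (negPf uf) andbF.
have is_ : i != sp S by apply: contraNneq iR => ->; apply: one_free_sp.
have ai := one_free_labs im is_ iR.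
have [vS' frS' eS'] := rotU vS im is_ ai.
have li : l != i by apply/eqP => E; rewrite E iu (negPf uf) in l1f.
have [j' [j'm j'l j's]] := rot_pos (lb S i) vS im is_ lm li.
have uj' : vend (rot S i (lb S i)) \in lb (rot S i (lb S i)) j'.
  by rewrite j'l eS' iu.
have j's' : j' != sp (rot S i (lb S i)) by rewrite j's.
have key u' : u' \in f -> u' != vbeg S ->
    vx (rot S i (lb S i)) j'.+1 = u' -> False.
  move=> u'f u'b E; apply: (crossUR vS' j'm j's' uj').
  by rewrite frS' E rot_vbeg nRf in_setD1 u'b u'f.
case: ifP => li' [_]; first by apply: key => //; rewrite /vbeg (vx_eq vS).
apply: key => //; rewrite /vbeg (vx_eq vS) ?(ltnW lm) //.
by move: li li'; case: (l) => // li li'; apply/eqP; lia.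
Qed.

(** The label at 0 contains both ends. Any other label through the first vertex links two vertices
    outside [f]: otherwise a rotation of the first end at it turns position 0 around and puts the
    old first vertex, a free neighbour of the new one, behind a label through the last vertex. At
    most [m + 2 - 2 * r] positions link two vertices outside [f]; with position 0 and the one free
    edge, the degree is too small once [3 < r]. *)
Lemma one_free_sp_neq0 : 3 < r -> sp S != 0 -> False.
Proof.
move=> r3 s0; have sm := sp_lt vS.
have [f fF [bf af nRf]] := one_free_edge.
have m0 : 0 < m by lia.
have s0' : 0 != sp S by rewrite eq_sym.
have f1 : vx S 1 \notin f.
  by apply/negP => f1; apply: (one_free_no_pair fF bf nRf m0 s0' bf f1).
have a_0 : vend S \in lb S 0.
  by apply: one_free_labs; rewrite // nRf in_setD1 (negPf f1) andbF.
pose A := [set j : 'I_m | vx S j \in f].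
pose B := [set j : 'I_m | vx S j.+1 \notin f].
have U00 (l : 'I_m) : l \in labs S (vbeg S) :\ Ordinal m0 -> l \in B :\: A.
  rewrite in_setD1 in_labs -val_eqE /= => /and3P[l0 ls bl].
  have lm := ltn_ord l; rewrite in_setD !inE -negb_or; apply/negP => lf.
  have l0' : 0 < l by rewrite lt0n.
  have l_lb : vx S l.+1 \in lb S l by case/andP: (lb_vx vS lm).
  have lx_lb : vx S l \in lb S l by case/andP: (lb_vx vS lm).
  have lb_ : vx S l != vbeg S by rewrite /vbeg (vx_eq vS) 1?ltnW.
  have lnf : lb S l != f by apply: fr_lb fF lm.
  have fin S' : valid S' -> vend S' = vend S -> vbeg S' = vx S l ->
      [/\ vx S' l.-1 = vx S 1, vx S' l.-1.+1 = vx S 0,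
        lb S' l.-1 = lb S 0 & (l.-1 == sp S') = (0 == sp S)] ->
      forall e, e \in fr S' -> vx S l \in e -> vbeg S \in e -> False.
    move=> vS' aS' bS' [_ x1 l1 s1] e eF le be.
    have l1m : l.-1 < m := leq_ltn_trans (leq_pred l) lm.
    apply: (crossUR vS' l1m); first by rewrite s1.
      by rewrite aS' l1.
    by rewrite x1 bS'; apply: (mem_nb eF) => //; rewrite eq_sym.
  have pos e := rotb_pos e vS lm ls m0 l0'; rewrite subn0 in pos.
  case/orP: lf => lf.
    have [vS' bS' aS' _ /(_ erefl) frS'] := rotb_spec (e := lb S l) vS lm ls
      (introT orP (or_intror (eqxx _))) l_lb bl.
    by apply: (fin _ vS' aS' bS' (pos _) f); rewrite ?frS'.
  have [vS' bS' aS' /(_ fF) frS' _] := rotb_spec (e := f) vS lm ls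
    (introT orP (or_introl fF)) lf bf.
  by apply: (fin _ vS' aS' bS' (pos _) (lb S l)); rewrite ?frS' ?setU11.
have cA : #|A| = r by rewrite /A (card_pos vS af) (fr_card vS fF).
have cB : #|B| = m - r.-1.
  have -> : B = ~: JR S.
    apply/setP => j; rewrite in_setC in_JR inE nRf in_setD1 /vbeg (vx_eq vS) //.
  by have := cardsC (JR S); rewrite card_ord (card_JR vS) qE; lia.
have AB : #|A :&: B| >= r.-1.
  have /subset_leq_card : A :\ Ordinal sm \subset A :&: B.
    apply/subsetP => j; rewrite in_setD1 -val_eqE in_setI /= => /andP[js jA].
    rewrite jA inE; move: jA; rewrite inE => jf; apply/negP => j1f.
    exact: (one_free_no_pair fF bf nRf (ltn_ord j) js jf j1f).
  by have := cardsD1 (Ordinal sm) A; rewrite cA; lia.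
have /subset_leq_card : labs S (vbeg S) :\ Ordinal m0 \subset B :\: A.
  by apply/subsetP => l; apply: U00.
have := cardsD1 (Ordinal m0) (labs S (vbeg S)).
have := cardsID A B; rewrite [B :&: A]setIC.
have := deg_split vS (vbeg S); have := degH (vbeg S).
have := fe_card1 vS (v := vbeg S); rewrite qE => /(_ _)/wrap[]; first by lia.
lia.
Qed.

End OneFreeEdge.

(** What remains is [sp S = 0]. Rotating the first end at some [l > 1] of [JR S] moves the special
    label to position [l.-1] and gives the last vertex no free edge. *)
Lemma one_free_false S : valid S -> #|nL S| = 0 -> #|nR S| = r.-1 ->
  m <= 2 * r -> (forall v, m.+1 <= degree H v + r) -> 3 < r -> False.
Proof.
move=> vS a0 qE n_le degH r3; have sm := sp_lt vS; have r2 := r_gt2.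
have [s0|s0] := eqVneq (sp S) 0; last first.
  exact: (one_free_sp_neq0 vS a0 qE n_le degH r3 s0).
have [f fF [bf af nRf]] := one_free_edge vS a0 qE n_le degH.
have [l lR l2] : exists2 l : 'I_m, l \in JR S & 1 < l.
  have cJ : #|JR S| = r.-1 by rewrite (card_JR vS).
  have m0 : 0 < m by lia.
  have m1 : 1 < m by have := max_card (JR S); rewrite card_ord; lia.
  have : 0 < #|JR S :\ Ordinal m0 :\ Ordinal m1|.
    have := cardsD1 (Ordinal m0) (JR S).
    by have := cardsD1 (Ordinal m1) (JR S :\ Ordinal m0); lia.
  case/card_gt0P => l; rewrite !in_setD1 -!val_eqE /= => /and3P[l1 l0 lR].
  by exists l => //; lia.
have lm := ltn_ord l; have ls : nat_of_ord l != sp S by rewrite s0; lia.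
have l1R : vx S l.+1 \in nR S by move: lR; rewrite in_JR.
have l1f : vx S l.+1 \in f by move: l1R; rewrite nRf in_setD1 => /andP[].
have al : vend S \notin lb S l by apply/negP => al; apply: (crossUR vS lm ls al l1R).
have [vS' bS' aS' /(_ fF) frS' _] := rotb_spec (e := f) vS lm ls
  (introT orP (or_introl fF)) l1f bf.
have a0' : #|nL (rotb S l f)| = 0 by rewrite aS' frS' nb_exch.
have ll : vx S l \in lb S l by case/andP: (lb_vx vS lm).
have q' : r.-1 <= #|nR (rotb S l f)|.
  by apply: (nb_ge vS' (e := lb S l)); rewrite ?bS' // frS' setU11.
have sl : sp S < l by rewrite s0; lia.
have [_ _ _ s'] := rotb_pos f vS lm ls sm sl.
apply: (one_free_sp_neq0 vS' a0') => //.
  have := labs_end vS'; have := deg_split vS' (vend (rotb S l f)).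
  rewrite (nb0_fe vS' a0') cards0.
  by have := degH (vend (rotb S l f)); lia.
by move: s'; rewrite eqxx => /eqP <-; rewrite s0; lia.
Qed.

(** A nonempty free neighbourhood has at least [r.-1] elements. As [m.+1 < 2 * r], two nonempty ones
    either have sum [m.+1], one of them being smaller than [r], or have exactly [r.-1] elements each
    and sum [m]. *)
Lemma large_r_false S : valid S -> fr S != set0 -> m.+1 < 2 * r ->
  (forall v, r.-1 <= degree H v) -> (r = 3 -> forall v, r <= degree H v) -> False.
Proof.
move=> vS F0 mr degH deg3; have r2 := r_gt2.
have [S1 vS1 n1] : exists2 S', valid S' & 0 < #|nL S'| + #|nR S'|.
  by apply: (ex_end_in_free vS F0) => v; have := degH v; lia.
have [S' vS' n'] : exists2 S', valid S' & 0 < #|nR S'|.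
  have [q0|q0] := posnP #|nR S1|; last by exists S1.
  exists (mir S1); first exact: mir_valid.
  by rewrite mir_fr mir_vbeg; lia.
have q1 := nb_gt0 vS' n'; have sm := sum_nb vS'.
have [p0|/(nb_gt0 vS') p1] := posnP #|nL S'|.
  have := labs_end vS'; have := deg_split vS' (vend S').
  rewrite (nb0_fe vS' p0) cards0; have d1 := degH (vend S').
  (* For [r = 3] this would give 3 labels and 2 free neighbours on at most 4 positions; this is how
     [3 < r] is obtained. *)
  have d3 : r = 3 -> r <= degree H (vend S') by move=> r3; apply: deg3.
  move=> dE lE; apply: (one_free_false vS' p0); try lia.
  by move=> v; have := degH v; lia.
have [E|E] := eqVneq (#|nL S'| + #|nR S'|) m.+1.
  have [pr|pr] := ltnP #|nL S'| r; first exact: (tight_false vS' E pr).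
  by apply: (tight_false_beg vS' E); lia.
by apply: (sum_m_false vS'); lia.
Qed.

(** * Small uniformity *)

Lemma rotF_nR S l e : valid S -> l < m -> l != sp S -> e \in fr S ->
  vx S l \in e -> vend S \in e -> nR (rot S l e) = nR S.
Proof.
move=> vS lm ls eF le ae; have [_ -> _] := rotF vS lm ls eF le ae.
apply: nb_exch; first by apply/negP => be; apply: (no_closing vS eF be ae).
apply/negP; apply: (crossLU vS lm ls); apply: (mem_nb eF) => //.
by rewrite /vend (vx_eq vS) // ?ltn_eqF // ltnW.
Qed.

Lemma swpF_nR S l e : valid S -> l < m -> l != sp S -> e \in fr S ->
  vx S l \in e -> vx S l.+1 \in e -> vbeg S \notin e -> vbeg S \notin lb S l ->
  nR (swp S l e) = nR S.
Proof.
move=> vS lm ls eF le l1e be bl; have [_ ->] := swpF vS lm ls eF le l1e.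
exact: nb_exch.
Qed.

Lemma inner_edges v (A : {set V}) : v \notin A ->
  #|[set e in H | (v \in e) && (e \subset v |: A)]| <= 'C(#|A|, r.-1).
Proof.
move=> vA; rewrite -cards_draws.
rewrite -(card_in_imset (f := fun e => e :\ v)
  (D := [set e in H | (v \in e) && (e \subset v |: A)])).
  apply: subset_leq_card; apply/subsetP => B /imsetP[e].
  move=> /setIdP[eH /andP[ve eA]] ->; rewrite inE.
  have := cardsD1 v e; rewrite ve (uH eH) => ->; rewrite eqxx andbT.
  by rewrite subDset.
move=> e f /setIdP[_ /andP[ve _]] /setIdP[_ /andP[vf _]] E.
by rewrite -(setD1K ve) E setD1K.
Qed.

Lemma outer_is_label S e v : valid S -> e \in H -> v \in e ->
  ~~ (e \subset v |: nb (fr S) v) ->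
  exists2 l, (l < m) && (l != sp S) & lb S l = e.
Proof.
move=> vS eH ve eN; have eF : e \notin fr S.
  apply: contra eN => eF; apply/subsetP => u ue; rewrite in_setU1.
  by have [//|uv] := eqVneq u v; rewrite (mem_nb eF).
move: eF; rewrite inE eH /= => /forallPn[l]; rewrite negbK => /eqP E.
exists l => //; rewrite ltn_ord /=.
by apply: contraNneq (sp_notin vS) => <-; rewrite E.
Qed.

(** Too few edges through [v] fit into [v] and its free neighbours, and an edge that does not fit
    cannot be free. *)
Lemma outer_label S v : valid S -> 'C(#|nb (fr S) v|, r.-1) < degree H v ->
  exists l, [/\ l < m, l != sp S, v \in lb S l &
                ~~ (lb S l \subset v |: nb (fr S) v)].
Proof.
move=> vS; have := inner_edges (negbT (nb_irr (fr S) v)) => /leq_ltn_trans h /h.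
rewrite /degree => lt_card.
have /exists_inP[e] : [exists e in [set e in H | v \in e],
    ~~ (e \subset v |: nb (fr S) v)].
  rewrite -negb_forall_in; apply/negP => /forall_inP sub.
  move: lt_card; rewrite ltnNge => /negP; apply; apply: subset_leq_card.
  apply/subsetP => e; move/(_ e): sub; rewrite !inE.
  by case: (e \in H) (v \in e) => [] [] //= ->.
rewrite inE => /andP[eH ve] eN; have [l /andP[lm ls] E] := outer_is_label vS eH ve eN.
by exists l; rewrite E.
Qed.

(* When the bound on the two neighbourhoods is attained, the neighbourhood of the
   last vertex is determined by the ordering and by that of the first vertex. *)
Lemma tight_max S1 S2 : valid S1 -> valid S2 -> vx S1 =1 vx S2 -> sp S1 = sp S2 ->
  nR S1 = nR S2 -> #|nL S2| + #|nR S2| = m.+1 -> nL S1 \subset nL S2.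
Proof.
move=> vS1 vS2 E spE RE t2; have [cov sL _] := nb_tight vS2 t2.
apply/subsetP => u uL; have ua : u != vend S1.
  by apply: contraTneq uL => ->; rewrite nb_irr.
have [j jm ju] := vx_onto_end vS1 ua.
have jL : vx S1 j \in nL S1 by rewrite ju.
rewrite -ju E; have [->//|js] := eqVneq j (sp S2).
apply: contraT => /(cov _ jm) jR; exfalso.
by apply: (crossLR vS1 jm _ jL); rewrite ?spE // RE E.
Qed.

(* Let [i] be the first position whose label contains the last vertex. After a rotation
   at any other such position [l], the counting bound is attained, which forces the new
   last vertex [vx S l.+1] into [lb S i]: this label gets more than [r] vertices. *)
Lemma tie_false S : valid S -> r <= #|labs S (vend S)| ->
  (forall l, l < m -> l != sp S -> vend S \in lb S l ->
     m <= #|labs (rot S l (lb S l)) (vx S l.+1)| + #|nR S|) -> False.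
Proof.
move=> vS rl H1; have r2 := r_gt2.
have [i0 i0L] : exists i : 'I_m, i \in labs S (vend S) by apply/card_gt0P; lia.
case: (@arg_minnP _ i0 (fun i : 'I_m => i \in labs S (vend S)) (@nat_of_ord m) i0L)
  => i iL imin.
have im := ltn_ord i; move: (iL); rewrite in_labs => /andP[is_ ai].
have iR : vx S i.+1 \notin nR S by apply/negP; apply: (crossUR vS im is_ ai).
have Ti (l : 'I_m) : l \in labs S (vend S) -> vx S l.+1 \in lb S i.
  move=> lL; have [E|il] := eqVneq l i; first by rewrite E; case/andP: (lb_vx vS im).
  have {}il : i < l by rewrite ltn_neqAle imin // andbT eq_sym.
  have lm := ltn_ord l; move: lL; rewrite in_labs => /andP[ls al].
  have [vS' frS' eS'] := rotU vS lm ls al.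
  have := H1 l lm ls al; set S' := rot S l (lb S l) in vS' frS' eS' *.
  have nRE : nR S' = nR S by rewrite frS'.
  rewrite -nRE -(card_JR vS') -eS'.
  have I0 : labs S' (vend S') :&: JR S' = set0.
    apply/setP => j; rewrite in_setI in_labs in_JR in_set0; apply/negP.
    by case/andP => /andP[js aj]; exact: (crossUR vS' (ltn_ord j) js aj).
  have := cardsUI (labs S' (vend S')) (JR S'); rewrite I0 cards0 addn0 => <- mU.
  have UT : labs S' (vend S') :|: JR S' = setT.
    by apply/eqP; rewrite eqEcard subsetT cardsT card_ord.
  have := in_setT i; rewrite -UT in_setU in_labs in_JR eS' nRE.
  by rewrite /= il (negPf iR) orbF => /andP[].
have /subset_leq_card : vx S i |: [set vx S l.+1 | l : 'I_m in labs S (vend S)]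
    \subset lb S i.
  apply/subsetP => u; rewrite in_setU1 => /orP[/eqP->|/imsetP[l lL ->]].
    by case/andP: (lb_vx vS im).
  exact: Ti.
rewrite cardsU1 (lb_card vS im is_) card_in_imset; last first.
  move=> j l _ _ /(vx_inj vS) E; apply: val_inj => /=.
  by have /(_ _ _)/eq_add_S := E; apply.
have -> : vx S i \notin [set vx S l.+1 | l : 'I_m in labs S (vend S)].
  apply/imsetP => -[l lL /eqP]; rewrite (vx_eq vS) // 1?ltnW // => /eqP E.
  by have := imin l lL; rewrite E ltnn.
by rewrite add1n => /leq_trans/(_ rl); rewrite ltnn.
Qed.

Section SmallUniformity.

Variable k : nat.
Hypothesis rk : r <= k.
Hypothesis mk : m.+1 = k.*2 \/ m = k.*2.
Hypothesis degH : forall v, 'C(k, r.-1) + 1 <= degree H v.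

Lemma deg_end S : valid S ->
  'C(k, r.-1) + 1 <= 'C(#|nL S|, r.-1) + #|labs S (vend S)|.
Proof.
move=> vS; have := degH (vend S); rewrite (deg_split vS).
by have := fe_bound vS (vend S) (fr_sub vS); lia.
Qed.

Lemma deg_beg S : valid S ->
  'C(k, r.-1) + 1 <= 'C(#|nR S|, r.-1) + #|labs S (vbeg S)|.
Proof.
move=> vS; have := degH (vbeg S); rewrite (deg_split vS).
by have := fe_bound vS (vbeg S) (fr_sub vS); lia.
Qed.

Lemma nb_sizes_valid S : valid S -> 0 < #|nL S| + #|nR S| ->
  nb_sizes m k r #|nL S| #|nR S|.
Proof.
move=> vS n0; have r2 := r_gt2.
have D1 := deg_end vS; have D2 := deg_beg vS.
have l1 := labs_end vS; have l2 := labs_beg vS.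
apply: nb_sizesP => //; first by rewrite r2.
- exact: (sum_nb vS).
- by lia.
- by lia.
- by have [->|/(nb_gt0 vS)] := posnP #|nL S|; [left|right].
- by have [->|/(nb_gt0 vS)] := posnP #|nR S|; [left|right].
- by lia.
- by lia.
Qed.

(** Some label at [l] through the last vertex leaves [nL S], and [vx S l] is a free neighbour by
    [nb_tight]. Rotating at [l] with a free edge or through the label gives the same vertex order,
    and the second state is tight again, so [tight_max] yields a free edge through [vx S l] and
    [vx S l.+1]. Once it is exchanged for the label, [tight_max] puts the vertices of the label back
    into [nL S]. *)
Lemma tight_k S : valid S -> #|nL S| = k -> #|nL S| + #|nR S| = m.+1 -> False.
Proof.
move=> vS pk pq; have r2 := r_gt2.
have [cov sL sR] := nb_tight vS pq.
have [l [lm ls al lN]] : exists l, [/\ l < m, l != sp S, vend S \in lb S l &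
    ~~ (lb S l \subset vend S |: nL S)].
  by apply: (outer_label vS); rewrite pk; have := degH (vend S); lia.
have l1R : vx S l.+1 \notin nR S by apply/negP; apply: (crossUR vS lm ls al).
have lL : vx S l \in nL S by apply: contraNT l1R; apply: cov.
have bl : vbeg S \notin lb S l by apply/negP; apply: (crossLU vS lm ls lL).
have [_ [e eF [le ae]]] := nbP _ _ _ lL.
have [vS1 frS1 eS1] := rotF vS lm ls eF le ae.
have [vS2 frS2 eS2] := rotU vS lm ls al.
have nR1 := rotF_nR vS lm ls eF le ae.
have nR2 : nR (rot S l (lb S l)) = nR S by rewrite frS2.
have t2 : #|nL (rot S l (lb S l))| + #|nR (rot S l (lb S l))| = m.+1.
  have n0 : 0 < #|nL (rot S l (lb S l))| + #|nR (rot S l (lb S l))|.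
    by rewrite nR2; clear -pk pq mk r2 rk; lia.
  move: (nb_sizes_valid vS2 n0); rewrite nR2 /nb_sizes.
  move: #|nL (rot _ _ _)| => p2; move: #|nL S| #|nR S| pk pq => p q pk pq.
  by clear -pk pq mk r2 rk; lia.
have sub12 := tight_max vS1 vS2 (fun _ => erefl) erefl (etrans nR1 (esym nR2)) t2.
have ll1 : vx S l != vx S l.+1 by rewrite (vx_eq vS) // ?ltn_eqF // ltnW.
have /andP[ll l1l] := lb_vx vS lm.
have /(subsetP sub12) : vx S l \in nL (rot S l e).
  by apply: (mem_nb (e := lb S l)); rewrite ?eS1 // frS1 setU11.
rewrite frS2 eS2 => /nbP[_ [g gF [lg l1g]]].
have bg : vbeg S \notin g.
  by apply: contra l1R => bg; apply: (mem_nb gF) => //; rewrite /vbeg (vx_eq vS).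
have [vS3 frS3] := swpF vS lm ls gF lg l1g.
have nR3 := swpF_nR vS lm ls gF lg l1g bg bl.
have sub3 := tight_max vS3 vS (fun _ => erefl) erefl nR3 pq.
case/negP: lN; apply/subsetP => u ul; rewrite in_setU1.
have [//|ua] := eqVneq u (vend S); rewrite /=; apply: (subsetP sub3).
by apply: (mem_nb (e := lb S l)) => //; rewrite frS3 setU11.
Qed.

Lemma tight_k_beg S : valid S -> #|nR S| = k -> #|nL S| + #|nR S| = m.+1 -> False.
Proof.
move=> vS pk pq; apply: (tight_k (mir_valid vS));
by rewrite mir_vend ?mir_vbeg mir_fr // addnC.
Qed.

(** * Odd order: at most k free neighbours at each end *)

Section Odd.

Hypothesis mE : m = k.*2.

Lemma nLR_le S : valid S -> #|nL S| <= k /\ #|nR S| <= k.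
Proof.
move=> vS; have [n0|n0] := posnP (#|nL S| + #|nR S|); first by lia.
have := nb_sizes_valid vS n0.
have t1 := tight_k vS; have t2 := tight_k_beg vS.
move: #|nL S| #|nR S| t1 t2 n0 => p q t1 t2 n0.
rewrite /nb_sizes => T; have {T} : (p = k /\ q = k.+1) \/ (p = k.+1 /\ q = k) \/
  (p <= k /\ q <= k) by clear -T mE; lia.
by case=> [[pk qk]|[[pk qk]|//]]; exfalso; [apply: t1|apply: t2]; lia.
Qed.

Lemma ends_k S : valid S -> #|nR S| = k ->
  #|nL S| = k \/ #|nL S| = k.-1 /\ (r = 3 \/ r = k).
Proof.
move=> vS qk; have [pk _] := nLR_le vS; have r2 := r_gt2.
have n0 : 0 < #|nL S| + #|nR S| by rewrite qk; lia.
have := nb_sizes_valid vS n0; rewrite qk.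
move: #|nL S| pk => p pk; rewrite /nb_sizes; clear -pk mE rk r2; lia.
Qed.

(** ['C(k, r.-1)] exceeds ['C(k.-1, r.-1)] by at least [k.-1], and only [k] positions are left for
    labels through the last vertex, so both bounds are attained. *)
Lemma poor_end S : valid S -> #|nR S| = k -> #|nL S| = k.-1 ->
  #|fe (fr S) (vend S)| = 'C(k.-1, r.-1) /\ k <= #|labs S (vend S)|.
Proof.
move=> vS qk pk; have r2 := r_gt2.
have := degH (vend S); rewrite (deg_split vS).
have := fe_bound vS (vend S) (fr_sub vS); rewrite pk.
have := labs_end vS; rewrite qk mE.
have E : 'C(k, r.-1) = 'C(k.-1, r.-1) + 'C(k.-1, r.-2).
  have -> : k = k.-1.+1 by lia.
  have -> : r.-1 = r.-2.+1 by lia.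
  by rewrite binS.
have := @bin_ge_upper k.-1 r.-2; rewrite {}E.
by clear -r2 rk; lia.
Qed.

Lemma full_fe S v (A : {set V}) : valid S ->
  #|fe (fr S) v| = 'C(#|nb (fr S) v|, r.-1) -> A \subset nb (fr S) v ->
  #|A| = r.-1 -> v |: A \in fr S.
Proof.
move=> vS full AN cA.
have sub : [set e :\ v | e in fe (fr S) v] \subset
    [set B : {set V} | B \subset nb (fr S) v & #|B| == r.-1].
  apply/subsetP => B /imsetP[e]; rewrite in_fe => /andP[eF ve] ->.
  rewrite inE nb_sub //=; have := cardsD1 v e.
  by rewrite ve (fr_card vS eF) => ->; rewrite eqxx.
have /eqP/setP/(_ A) : [set e :\ v | e in fe (fr S) v] ==
    [set B : {set V} | B \subset nb (fr S) v & #|B| == r.-1].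
  rewrite eqEcard sub cards_draws -full card_in_imset ?leqnn //.
  move=> e f; rewrite !in_fe => /andP[_ ve] /andP[_ vf] E.
  by rewrite -(setD1K ve) E setD1K.
rewrite [in RHS]inE AN cA eqxx => /imsetP[e]; rewrite in_fe => /andP[eF ve] ->.
by rewrite setD1K.
Qed.

Definition outer_end S l := [/\ l < m, l != sp S, vend S \in lb S l &
  ~~ (lb S l \subset vend S |: nL S)].

Definition outer_beg S l := [/\ l < m, l != sp S, vbeg S \in lb S l &
  ~~ (lb S l \subset vbeg S |: nR S)].

(** If [vx S l] and [vx S l.+1] share a free edge that avoids the last vertex, exchanging it for the
    label enlarges [nL S] beyond [k]. If they share none, compare the two rotations at [l]: the free
    neighbours of [vx S l.+1] are only [k.-1] and, by [poor_end], span all possible free edges with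
    it. The last vertex and an outer vertex [w] of the label are among them, hence share a free
    edge, although [w] is not in [nL S]. *)
Lemma swappable S l : valid S -> #|nL S| = k -> #|nR S| = k -> outer_end S l ->
  vx S l \in nL S ->
  exists2 g, g \in fr S & [/\ vx S l \in g, vx S l.+1 \in g & vend S \in g].
Proof.
move=> vS pk qk [lm ls al lN] lL; have r2 := r_gt2.
have [w [wl wa wN]] := subsetU1P lN.
have l1R : vx S l.+1 \notin nR S by apply/negP; apply: (crossUR vS lm ls al).
have bl : vbeg S \notin lb S l by apply/negP; apply: (crossLU vS lm ls lL).
have [_ [e eF [le ae]]] := nbP _ _ _ lL.
have [vS2 frS2 eS2] := rotU vS lm ls al.
have nR2 : nR (rot S l (lb S l)) = nR S by rewrite frS2.
have ll1 : vx S l != vx S l.+1 by rewrite (vx_eq vS) // ?ltn_eqF // ltnW.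
have la : vx S l != vend S by rewrite /vend (vx_eq vS) // ?ltn_eqF // ltnW.
have /andP[ll l1l] := lb_vx vS lm.
have qk2 : #|nR (rot S l (lb S l))| = k by rewrite nR2.
have [] := boolP (vx S l \in nL (rot S l (lb S l))); rewrite frS2 eS2.
  case/nbP => _ [g gF [lg l1g]].
  have [ag|ag] := boolP (vend S \in g); first by exists g.
  have [vS3 frS3] := swpF vS lm ls gF lg l1g.
  have [+ _] := nLR_le vS3; rewrite leqNgt => /negP[].
  have : w |: nL S \subset nL (swp S l g).
    rewrite subUset sub1set frS3 (mem_nb (e := lb S l)) ?setU11 //=.
    apply/subsetP => u /nbP[ua [f fF [uf af]]]; apply: (mem_nb (e := f)) => //.
    by rewrite in_setU1 in_setD1 fF (contraNneq _ ag) ?orbT // => <-.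
  by move/subset_leq_card; rewrite cardsU1 wN pk.
move=> lM; exfalso.
have ce : vx S l.+1 \notin e by apply: contra lM => ce; apply: (mem_nb eF).
have [vS1 frS1 eS1] := rotF vS lm ls eF le ae.
have sub : lb S l :\ vx S l.+1 \subset nL (rot S l e).
  by rewrite eS1; apply: nb_sub; rewrite // frS1 setU11.
have subM : nb (fr S) (vx S l.+1) \subset nL (rot S l e).
  rewrite eS1 frS1; apply/subsetP => u /nbP[uc [f fF [uf cf]]].
  apply: (mem_nb (e := f)) => //.
  by rewrite in_setU1 in_setD1 fF (contraNneq _ ce) ?orbT // => <-.
have [p1 _] := nLR_le vS1.
have lL1 : vx S l \in nL (rot S l e) by apply: (subsetP sub); rewrite in_setD1 ll1.
have subU : vx S l |: nb (fr S) (vx S l.+1) \subset nL (rot S l e).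
  by rewrite subUset sub1set lL1.
have := subset_leq_card subU; rewrite cardsU1 lM add1n => cM.
have pk1 : #|nb (fr S) (vx S l.+1)| = k.-1.
  by have := ends_k vS2 qk2; rewrite frS2 eS2; clear -cM p1; lia.
have UE : vx S l |: nb (fr S) (vx S l.+1) = nL (rot S l e).
  by apply/eqP; rewrite eqEcard subU cardsU1 lM pk1; clear -p1 r2 rk; lia.
have [full _] : #|fe (fr S) (vx S l.+1)| = 'C(k.-1, r.-1) /\
    k <= #|labs (rot S l (lb S l)) (vx S l.+1)|.
  by have := poor_end vS2 qk2; rewrite frS2 eS2; apply.
have inM u : u \in lb S l -> u != vx S l.+1 -> u != vx S l ->
    u \in nb (fr S) (vx S l.+1).
  move=> ul uc ulx; have : u \in nL (rot S l e).
    by apply: (subsetP sub); rewrite in_setD1 uc.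
  by rewrite -UE in_setU1 (negPf ulx).
have ac : vend S != vx S l.+1 by apply: contraNneq ce => <-.
have aM := inM _ al ac (negbT (etrans (eq_sym _ _) (negPf la))).
have cL : vx S l.+1 \in nL S by rewrite nb_sym.
have wM : w \in nb (fr S) (vx S l.+1).
  apply: inM => //; first by apply: contraNneq wN => ->.
  by apply: contraNneq wN => ->.
have awM : [set vend S; w] \subset nb (fr S) (vx S l.+1).
  by rewrite subUset !sub1set aM.
have cB : #|[set vend S; w]| <= r.-1 <= #|nb (fr S) (vx S l.+1)|.
  by rewrite cards2 pk1; clear -r2 rk; case: eqP; lia.
have [A [awA AM cA]] := ex_subset_between awM cB.
case/negP: wN; apply: (mem_nb (full_fe vS _ AM cA)) => //.
- by rewrite full pk1.
- by rewrite in_setU1 (subsetP awA) ?orbT // !inE eqxx orbT.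
- by rewrite in_setU1 (subsetP awA) ?orbT // !inE eqxx.
Qed.

Lemma outer_end_mir S l : valid S -> outer_beg S l -> outer_end (mir S) (m.-1 - l).
Proof.
move=> vS [lm ls bl lN]; have sm := sp_lt vS; split.
- by clear -lm; lia.
- by rewrite /=; clear -lm ls sm; lia.
- by rewrite mir_vend /= (_ : m.-1 - (m.-1 - l) = l) //; clear -lm; lia.
- by rewrite mir_vend mir_fr /= (_ : m.-1 - (m.-1 - l) = l) //; clear -lm; lia.
Qed.

Lemma swappable_beg S l : valid S -> #|nL S| = k -> #|nR S| = k -> outer_beg S l ->
  vx S l.+1 \in nR S ->
  exists2 g, g \in fr S & [/\ vx S l \in g, vx S l.+1 \in g & vbeg S \in g].
Proof.
move=> vS pk qk oS lR; have lm : l < m by case: oS.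
have E1 : m - (m.-1 - l) = l.+1 by clear -lm; lia.
have E2 : m - (m.-1 - l).+1 = l by clear -lm; lia.
have := swappable (mir_valid vS).
rewrite mir_vend mir_vbeg mir_fr => /(_ _ qk pk (outer_end_mir vS oS)).
by rewrite /= E1 E2 => /(_ lR)[g gF [lg l1g bg]]; exists g.
Qed.

(** * Both ends with k free neighbours *)

Section BothK.

Variable S : state V.
Hypotheses (vS : valid S) (pk : #|nL S| = k) (qk : #|nR S| = k).

(** Exchanging the label at [l] makes its outer vertex, at position [o], a free neighbour of the
    last vertex; by counting, every position other than [o] and [sp S] is then covered. The same
    reasoning at the first vertex gives a label at [l'] with an outer vertex right after a position
    [o'], and [o' = o]. Both exchanges together contradict [double_swap]. *)
Lemma outer_end_in l : outer_end S l -> vx S l \in nL S -> False.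
Proof.
move=> oS lL; have [lm ls al lN] := oS.
have [g gF [lg l1g ag]] := swappable vS pk qk oS lL.
have [w [wl wa wN]] := subsetU1P lN.
have [o om ow] := vx_onto_end vS wa.
have bl : vbeg S \notin lb S l by apply/negP; apply: (crossLU vS lm ls lL).
have bg : vbeg S \notin g by apply/negP => bg; apply: (no_closing vS gF bg ag).
have [vS3 frS3] := swpF vS lm ls gF lg l1g.
have nR3 := swpF_nR vS lm ls gF lg l1g bg bl.
have oL3 : vx S o \in nL (swp S l g).
  by apply: (mem_nb (e := lb S l)); rewrite ?ow // frS3 setU11.
have oL : vx S o \notin nL S by rewrite ow.
have ol : o != l by apply: contraNneq oL => ->.
have oR : o != sp S -> vx S o.+1 \notin nR S.
  by move=> os; apply/negP => oR; apply: (crossLR vS3 om os oL3); rewrite nR3.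
have ob : o != sp S -> vbeg S \notin lb S o.
  move=> os; apply/negP => ob; apply: (crossLU vS3 om os oL3).
  by rewrite /= (negPf ol).
have cov j : j < m -> j != o -> j != sp S -> vx S j \notin nL S ->
    vx S j.+1 \in nR S.
  move=> jm jo js jL; apply: contraT => jR; exfalso.
  have cJ := card_JL vS; have cR := card_JR vS.
  have UI := cardsUI (JL S) (JR S).
  have [E|os] := eqVneq o (sp S).
    have I0 : #|JL S :&: JR S| = 0.
      apply/eqP; rewrite cards_eq0 -subset0; apply/subsetP => i.
      rewrite in_setI => /andP[iL iR]; move: (iL) oL.
      by rewrite in_JL (JLR_sub vS iL iR) E => ->.
    have : #|Ordinal jm |: (JL S :|: JR S)| <= m by rewrite -[leqRHS]card_ord max_card.
    rewrite cardsU1 in_setU in_JL in_JR /= (negPf jL) (negPf jR) /=.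
    by move: UI; rewrite I0 cJ cR pk qk addn0 => ->; clear -mE; lia.
  have I1 : #|JL S :&: JR S| <= 1.
    apply/card_le1_eqP => i i'; rewrite !in_setI => /andP[iL iR] /andP[i'L i'R].
    by apply: val_inj; rewrite /= (JLR_sub vS iL iR) (JLR_sub vS i'L i'R).
  have : #|Ordinal om |: (Ordinal jm |: (JL S :|: JR S))| <= m.
    by rewrite -[leqRHS]card_ord max_card.
  rewrite !cardsU1 in_setU1 !in_setU !in_JL !in_JR -val_eqE /=.
  rewrite (negPf jL) (negPf jR) (negPf oL) (negPf (oR os)) [o == j]eq_sym (negPf jo) /=.
  have {}UI : k + k <= #|JL S :|: JR S| + 1.
    by move: UI I1; rewrite cJ cR pk qk; clear; lia.
  by move: UI; set c := #|JL S :|: JR S|; clear -mE; lia.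
have [l' oB] : exists l', outer_beg S l'.
  have [|l' [? ? ? ?]] := outer_label vS (v := vbeg S); last by exists l'.
  by rewrite qk; have := degH (vbeg S); clear; lia.
have [lm' ls' bl' lN'] := oB.
have l'L : vx S l' \notin nL S.
  by apply/negP => l'L; apply: (crossLU vS lm' ls' l'L).
have l'o : l' != o.
  apply/eqP => E; have := ob; rewrite -E ls' => /(_ isT).
  by rewrite bl'.
have l'R := cov _ lm' l'o ls' l'L.
have [g' g'F [lg' l1g' bg']] := swappable_beg vS pk qk oB l'R.
have ag' : vend S \notin g' by apply/negP => ag'; apply: (no_closing vS g'F bg' ag').
have gg' : g != g' by apply: contraNneq bg => ->.
have l'l : l' != l by apply: contraNneq l'L => ->.
have al' : vend S \notin lb S l' by apply/negP => al'; apply: (crossUR vS lm' ls' al').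
have [w' [w'l w'b w'N]] := subsetU1P lN'.
have [o' om' ow'] := vx_onto_beg vS w'b.
have o'R : vx S o'.+1 \notin nR S by rewrite ow'.
have o's : o' != sp S -> vx S o' \notin nL S.
  move=> os'; apply/negP => o'L.
  apply: (swap_beg vS lm' ls' g'F lg' l1g' bl' ag' om' os' _ o'L).
  by rewrite ow'.
have [E|os] := eqVneq o (sp S).
  have os' : o' != sp S.
    apply: contraNneq o'R => E'.
    apply: contraT => sR; exfalso.
    have I0 : #|JL S :&: JR S| = 0.
      apply/eqP; rewrite cards_eq0 -subset0; apply/subsetP => i.
      rewrite in_setI => /andP[iL iR]; move: (iL) oL.
      by rewrite in_JL (JLR_sub vS iL iR) E => ->.
    have : #|Ordinal om |: (JL S :|: JR S)| <= m by rewrite -[leqRHS]card_ord max_card.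
    rewrite cardsU1 in_setU in_JL in_JR /= (negPf oL) E -E' (negPf sR) /=.
    have := cardsUI (JL S) (JR S).
    rewrite (card_JL vS) (card_JR vS) I0 pk qk addn0 => ->.
    by clear -mE; lia.
  have o'o : o' != o by rewrite E.
  by move: o'R; rewrite (cov _ om' o'o os' (o's os')).
have os' : o' != sp S.
  apply: contraNneq o'R => ->; apply: contraT => sR; exfalso.
  have I0 : #|JL S :&: JR S| = 0.
    apply/eqP; rewrite cards_eq0 -subset0; apply/subsetP => i.
    rewrite in_setI => /andP[iL iR]; move: (iR) sR.
    by rewrite in_JR (JLR_sub vS iL iR) => ->.
  have : #|Ordinal om |: (JL S :|: JR S)| <= m by rewrite -[leqRHS]card_ord max_card.
  rewrite cardsU1 in_setU in_JL in_JR /= (negPf oL) (negPf (oR os)) /=.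
  have := cardsUI (JL S) (JR S).
  rewrite (card_JL vS) (card_JR vS) I0 pk qk addn0 => ->.
  by clear -mE; lia.
have o'o : o' = o.
  by apply/eqP; apply: contraNT o'R => o'o; apply: cov => //; apply: o's.
apply: (double_swap vS lm ls lm' ls' l'l gF g'F gg' lg l1g lg' l1g' om os al _ bl').
  by rewrite ow.
by rewrite -o'o ow'.
Qed.

End BothK.

Lemma outer_end_notin S l : valid S -> #|nL S| = k -> #|nR S| = k ->
  outer_end S l -> vx S l \notin nL S /\ vx S l.+1 \notin nR S.
Proof.
move=> vS pk qk oS; split; apply/negP.
  exact: (outer_end_in vS pk qk oS).
by case: oS => lm ls al _; apply: (crossUR vS lm ls al).
Qed.

Lemma outer_beg_notin S l : valid S -> #|nL S| = k -> #|nR S| = k ->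
  outer_beg S l -> vx S l \notin nL S /\ vx S l.+1 \notin nR S.
Proof.
move=> vS pk qk oS; have [lm ls bl _] := oS; split; apply/negP.
  by move=> lL; apply: (crossLU vS lm ls lL bl).
move=> lR; have oM := outer_end_mir vS oS.
have E1 : m - (m.-1 - l) = l.+1 by clear -lm; lia.
have := outer_end_in (mir_valid vS) _ _ oM.
by rewrite mir_vend mir_vbeg mir_fr /= E1; apply.
Qed.

Record uncovered S o : Prop := Uncovered {
  unc_lt : o < m;
  unc_sp : o != sp S;
  unc_L : vx S o \notin nL S;
  unc_R : vx S o.+1 \notin nR S;
  unc_end : outer_end S o;
  unc_beg : outer_beg S o;
  unc_beg_uniq : forall l, outer_beg S l -> l = o }.

(** Two sets of [k] among [k.*2] positions with at most one common element miss at most one position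
    other than [sp S], and the outer labels of both ends sit at missed positions. So they are one
    and the same label. *)
Lemma ex_uncovered S : valid S -> #|nL S| = k -> #|nR S| = k ->
  exists o, uncovered S o.
Proof.
move=> vS pk qk.
have [l [lm ls al lN]] : exists l, outer_end S l.
  have [|l [? ? ? ?]] := outer_label vS (v := vend S); last by exists l.
  by rewrite pk; have := degH (vend S); clear; lia.
have oL : outer_end S l by [].
have [lL lR] := outer_end_notin vS pk qk oL.
have uniq l' : outer_beg S l' -> l' = l.
  move=> oB; have [l'm l's _ _] := oB.
  have [l'L l'R] := outer_beg_notin vS pk qk oB.
  apply/eqP; apply: contraT => l'l; exfalso.
  have I1 : #|JL S :&: JR S| <= 1.
    apply/card_le1_eqP => i i'; rewrite !in_setI => /andP[iL iR] /andP[i'L i'R].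
    by apply: val_inj; rewrite /= (JLR_sub vS iL iR) (JLR_sub vS i'L i'R).
  have : #|Ordinal l'm |: (Ordinal lm |: (JL S :|: JR S))| <= m.
    by rewrite -[leqRHS]card_ord max_card.
  rewrite !cardsU1 in_setU1 !in_setU !in_JL !in_JR -val_eqE /=.
  rewrite (negPf lL) (negPf lR) (negPf l'L) (negPf l'R) (negPf l'l) /=.
  have := cardsUI (JL S) (JR S); rewrite (card_JL vS) (card_JR vS) pk qk.
  move=> UI; have {}UI : k + k <= #|JL S :|: JR S| + 1.
    by move: UI I1; clear; lia.
  by move: UI; set c := #|JL S :|: JR S|; clear -mE; lia.
have [l' oB] : exists l', outer_beg S l'.
  have [|l' [? ? ? ?]] := outer_label vS (v := vbeg S); last by exists l'.
  by rewrite qk; have := degH (vbeg S); clear; lia.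
exists l; split=> //; by rewrite -(uniq _ oB).
Qed.

Section UncoveredPosition.

Variables (S : state V) (o : nat).
Hypotheses (vS : valid S) (pk : #|nL S| = k) (qk : #|nR S| = k).
Hypothesis uo : uncovered S o.

(** Leaving [nR S] around the first vertex is a property of the edge alone, so an edge found in
    another state can be tested in [S], where [lb S o] is the only candidate. *)
Lemma outer_uniq S' e : valid S' -> nR S' = nR S -> vbeg S' = vbeg S ->
  e \in H -> vbeg S \in e -> ~~ (e \subset vbeg S |: nR S) -> e = lb S o.
Proof.
move=> vS' _ _ eH be eN; have [l /andP[lm ls] E] := outer_is_label vS eH be eN.
by rewrite -E (unc_beg_uniq uo (l := l)) //; split; rewrite ?E.
Qed.

(** After a rotation at [j] with [f], the edge [h] is still free at [vx S o.+1]. If one edge [f0]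
    takes both roles, a free edge [f2] of the last vertex outside [f0] helps: it either contains
    [vx S o.+1] or, as [r = k], consists of the last vertex and all of [nL S] except [vx S o.+1],
    and so contains [vx S j]. *)
Lemma spare_edge j : j < o -> j != sp S -> vx S j \in nL S -> r = k ->
  exists f h, [/\ f \in fr S, h \in fr S, h != f, vx S j \in f /\ vend S \in f &
    vx S o.+1 \in h].
Proof.
move=> jo js jL rE; have r2 := r_gt2.
have [om os ao _] := unc_end uo; have jm : j < m := ltn_trans jo om.
have [vS' frS' eS'] := rotU vS om os ao.
have qk' : #|nR (rot S o (lb S o))| = k by rewrite frS'.
have [h hF oh] : exists2 h, h \in fr S & vx S o.+1 \in h.
  have := ends_k vS' qk'; rewrite frS' eS' => pE.
  have /card_gt0P[u /nbP[_ [h hF [_ oh]]]] : 0 < #|nb (fr S) (vx S o.+1)|.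
    by clear -pE r2 rk; lia.
  by exists h.
have [_ [f0 f0F [jf0 af0]]] := nbP _ _ _ jL.
have [E|hf] := eqVneq h f0; last by exists f0, h.
subst h.
have [z zL zf0] : exists2 z, z \in nL S & z \notin f0.
  have : f0 :\ vend S \proper nL S.
    rewrite properEcard nb_sub //= pk; have := cardsD1 (vend S) f0.
    by rewrite af0 (fr_card vS f0F); clear -r2 rk; lia.
  case/properP => _ [z zL]; rewrite in_setD1 => zf; exists z => //.
  by move: zf; have [E|//] := eqVneq z (vend S); move: zL; rewrite E nb_irr.
have [_ [f2 f2F [zf2 af2]]] := nbP _ _ _ zL.
have f02 : f0 != f2 by apply: contraNneq zf0 => ->.
have [o2|o2] := boolP (vx S o.+1 \in f2).
  by exists f0, f2; split; rewrite // eq_sym.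
exists f2, f0; split=> //; split=> //.
have oa : vx S o.+1 != vend S by apply: contraNneq o2 => ->.
have oL : vx S o.+1 \in nL S := mem_nb f0F oh af0 oa.
have sub : f2 :\ vend S \subset nL S :\ vx S o.+1.
  apply/subsetP => u; rewrite !in_setD1 => /andP[ua u2].
  rewrite (mem_nb f2F u2 af2 ua) andbT; by apply: contraNneq o2 => <-.
have /eqP E : f2 :\ vend S == nL S :\ vx S o.+1.
  rewrite eqEcard sub; have := cardsD1 (vend S) f2; rewrite af2 (fr_card vS f2F).
  have := cardsD1 (vx S o.+1) (nL S); rewrite oL pk.
  by clear -rE; lia.
have : vx S j \in nL S :\ vx S o.+1.
  by rewrite in_setD1 jL andbT (vx_eq vS) // ?(ltnW jm) //; clear -jo; lia.
by rewrite -E in_setD1 => /andP[].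
Qed.

(** Rotate at [j], so that [vx S j.+1] becomes the last vertex. With [k] free neighbours again, the
    new state has an uncovered label, which contains both ends and must be [lb S o] by [outer_uniq].
    With [k.-1], labels and [JR] fill all positions, so if [lb S o] misses the new end, it is
    traversed backwards and [vx S o] lies in [nR S]. *)
Lemma end_in_label j : j < m -> j != sp S -> vx S j \in nL S -> vx S j.+1 \in lb S o.
Proof.
move=> jm js jL; have r2 := r_gt2.
have [om os oL oR [_ _ ao aN] [_ _ bo bN] _] := uo.
have [f [fF jf af hf]] : exists f, [/\ f \in fr S, vx S j \in f, vend S \in f &
    j < o -> r = k -> exists2 h, h \in fr S :\ f & vx S o.+1 \in h].
  have [_ [f fF [jf af]]] := nbP _ _ _ jL.
  have [jo|jo] := ltnP j o; last by exists f; split.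
  have [rE|rE] := eqVneq r k; last by exists f; split=> // _ E; rewrite E eqxx in rE.
  have [f' [h [f'F hF hf' [jf' af'] oh]]] := spare_edge jo js jL rE.
  by exists f'; split=> // _ _; exists h; rewrite // in_setD1 hf'.
have [vS' frS' eS'] := rotF vS jm js fF jf af.
have nR' := rotF_nR vS jm js fF jf af.
have qk' : #|nR (rot S j f)| = k by rewrite nR'.
have jo : o != j by apply: contraNneq oL => ->.
have [o' [o'm o'l o's pos]] := rot_pos f vS jm js om jo.
have gH : lb S o \in H := lb_edge vS om os.
rewrite -eS'; have [pk'|[pk' rE]] := ends_k vS' qk'.
  have [o1 uo1] := ex_uncovered vS' pk' qk'.
  have [o1m o1s ao1 _] := unc_end uo1; have [_ _ bo1 bo1N] := unc_beg uo1.
  rewrite -(outer_uniq vS' nR' erefl (lb_edge vS' o1m o1s)) //.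
  by rewrite -nR'.
have [_ lk] := poor_end vS' qk' pk'.
apply: contraT => cN; exfalso; have bS' : vbeg (rot S j f) = vbeg S by [].
set S' := rot S j f in vS' frS' eS' nR' qk' o'l o's pos pk' lk cN bS' *.
clearbody S'.
have o's' : o' != sp S' by rewrite o's.
have o'R : vx S' o'.+1 \in nR S.
  have I0 : labs S' (vend S') :&: JR S' = set0.
    apply/setP => i; rewrite in_setI in_labs in_JR in_set0; apply/negP.
    by case/andP => /andP[is_ ai]; exact: (crossUR vS' (ltn_ord i) is_ ai).
  have := cardsUI (labs S' (vend S')) (JR S'); rewrite I0 cards0 addn0.
  rewrite (card_JR vS') qk' => cU.
  have UT : labs S' (vend S') :|: JR S' = setT.
    apply/eqP; rewrite eqEcard subsetT cardsT card_ord cU.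
    by clear -mE lk; lia.
  have := in_setT (Ordinal o'm).
  by rewrite -UT in_setU in_labs in_JR /= o'l (negPf cN) andbF nR'.
have jo' : j < o.
  rewrite ltn_neqAle eq_sym jo /= leqNgt; apply/negP => oj.
  by move: pos; rewrite oj => -[_ E]; rewrite E (negPf oR) in o'R.
have {pos} [x1 x2] : vx S' o' = vx S o.+1 /\ vx S' o'.+1 = vx S o.
  by move: pos; rewrite ltnNge (ltnW jo').
have bo' : vbeg S' \in lb S' o' by rewrite o'l bS'.
have oo : vx S' o' \notin nR S by rewrite x1.
have ob : vx S o.+1 != vbeg S by rewrite (vx_eq vS).
move: (o'R); rewrite x2 -nR' bS' => /nbP[ob0 [g gF [og bg]]].
have o1g : vx S' o' \notin g.
  by apply: contra oo => o1g; rewrite -nR' bS' x1; rewrite x1 in o1g; apply: (mem_nb gF).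
have nRS : nb (fr S') (vbeg S) = nR S by rewrite -nR' bS'.
(* [M] becomes the free neighbourhood of the first vertex when the first end is rotated at [o']
   through the label. Rotating with [g] instead adds [vx S o] and the old first vertex to it, so [M]
   has at most [k - 2] elements; the possible sizes then leave only the empty set, against the spare
   edge [h]. *)
set M := nb (fr S') (vx S o.+1).
have oM : vx S o \notin M.
  apply/negP => /nbP[oo1 [h hF [oh o1h]]].
  have bh : vbeg S \notin h.
    by apply: contra oR => bh; rewrite -nRS; apply: (mem_nb hF).
  have [vS4 frS4] := swpF vS' o'm o's' hF (eq_ind_r (fun z => z \in h) o1h x1)
    (eq_ind_r (fun z => z \in h) oh x2).
  have [_] := nLR_le vS4; rewrite leqNgt => /negP; apply.
  have [w [wl wb wN]] := subsetU1P bN.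
  have : w |: nR S \subset nR (swp S' o' h).
    have bS4 : vbeg (swp S' o' h) = vbeg S := bS'.
    rewrite bS4 subUset sub1set frS4 o'l (mem_nb (e := lb S o)) ?setU11 //=.
    apply/subsetP => u; rewrite -nRS => /nbP[ub [e eF [ue be]]].
    apply: (mem_nb (e := e)) => //.
    by rewrite in_setU1 in_setD1 eF (contraNneq _ bh) ?orbT // => <-.
  by move/subset_leq_card; rewrite cardsU1 wN qk.
have bM : vbeg S \notin M.
  by rewrite /M nb_sym nRS.
have bo'1 : vx S' o'.+1 \in lb S' o' by rewrite x2 o'l; case/andP: (lb_vx vS om).
have bo'0 : vx S o.+1 \in lb S o by case/andP: (lb_vx vS om).
have oo' : vx S o \in lb S o by case/andP: (lb_vx vS om).
have [vS2 bS2 aS2 _ /(_ erefl) frS2] := rotb_spec (e := lb S' o') vS' o'm o's'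
  (introT orP (or_intror (eqxx _))) bo'1 bo'.
have [vS3 bS3 aS3 /(_ gF) frS3 _] := rotb_spec (e := g) vS' o'm o's'
  (introT orP (or_introl gF)) (eq_ind_r (fun z => z \in g) og x2)
  (eq_ind_r (fun z => z \in g) bg bS').
have M2 : #|M| + 2 <= k.
  have [_] := nLR_le vS3; rewrite bS3 x1 frS3 o'l; apply: leq_trans.
  have : vx S o |: (vbeg S |: M) \subset nb (lb S o |: fr S' :\ g) (vx S o.+1).
    rewrite !subUset !sub1set.
    rewrite !(mem_nb (e := lb S o)) ?setU11 //= 1?eq_sym //; last first.
      by rewrite (vx_eq vS) // 1?ltnW // gtn_eqF.
    apply/subsetP => u /nbP[uo1 [e eF [ue oe]]]; apply: (mem_nb (e := e)) => //.
    rewrite in_setU1 in_setD1 eF (contraNneq _ o1g) ?orbT // => <-.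
    by rewrite x1.
  move/subset_leq_card; apply: leq_trans.
  by rewrite !cardsU1 in_setU1 negb_or oM bM ob0 /= addnC addnA.
have n0 : 0 < #|nL (rotb S' o' (lb S' o'))| + #|nR (rotb S' o' (lb S' o'))|.
  by rewrite aS2 frS2 pk'; clear -rE r2 rk; lia.
have := nb_sizes_valid vS2 n0; rewrite bS2 aS2 frS2 x1 pk' -/M => FT.
have [rE' M0] : r = k /\ #|M| = 0.
  move: FT; rewrite /nb_sizes; clear -M2 r2 rk mE; move: #|M| M2 => c M2 FT; lia.
have [h hF oh] := hf jo' rE'.
have hF' : h \in fr S' by rewrite frS' in_setU1 hF orbT.
have := nb_ge vS' hF' oh; rewrite -/M M0; clear -r2; lia.
Qed.

(** By [end_in_label], [lb S o] contains the first vertex, [vx S o.+1] and at least [k.-1] further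
    vertices: more than [r]. *)
Lemma uncovered_false : False.
Proof.
have r2 := r_gt2; have sm := sp_lt vS.
have [om os oL oR [_ _ ao aN] [_ _ bo bN] _] := uo.
pose T := [set vx S j.+1 | j : 'I_m in JL S :\ Ordinal sm].
have cT : k.-1 <= #|T|.
  rewrite card_in_imset.
    by have := cardsD1 (Ordinal sm) (JL S); rewrite (card_JL vS) pk; clear; lia.
  move=> i j _ _ /(vx_inj vS) E; apply: val_inj => /=.
  by have /(_ _ _)/eq_add_S := E; apply.
have : vbeg S |: (vx S o.+1 |: T) \subset lb S o.
  rewrite !subUset !sub1set bo /=; apply/andP; split.
    by case/andP: (lb_vx vS om).
  apply/subsetP => u /imsetP[j]; rewrite in_setD1 in_JL -val_eqE => /andP[js jL] ->.
  exact: end_in_label.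
move/subset_leq_card; rewrite !cardsU1 (lb_card vS om os).
have -> : vx S o.+1 \notin T.
  apply/imsetP => -[j]; rewrite in_setD1 in_JL => /andP[_ jL] /eqP.
  by rewrite (vx_eq vS) // eqSS => /eqP E; rewrite E jL in oL.
have -> : vbeg S \notin vx S o.+1 |: T.
  rewrite in_setU1 negb_or (vx_eq vS) //=; apply/imsetP => -[j _ /eqP].
  by rewrite (vx_eq vS).
by rewrite /= => le_r; clear -le_r cT rk r2; lia.
Qed.

End UncoveredPosition.

Lemma both_k_false S : valid S -> #|nL S| = k -> #|nR S| = k -> False.
Proof.
move=> vS pk qk; have [o uo] := ex_uncovered vS pk qk.
exact: (uncovered_false vS pk qk uo).
Qed.

End Odd.

Lemma bin_pred_le : 'C(k.-1, r.-1) + k.-1 <= 'C(k, r.-1).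
Proof.
have r2 := r_gt2.
have -> : 'C(k, r.-1) = 'C(k.-1, r.-1) + 'C(k.-1, r.-2).
  have -> : k = k.-1.+1 by clear -r2 rk; lia.
  have -> : r.-1 = r.-2.+1 by clear -r2; lia.
  by rewrite binS.
by rewrite leq_add2l; apply: bin_ge_upper; clear -r2 rk; lia.
Qed.

Lemma deg_end_pred S : valid S -> #|nL S| = k.-1 -> k <= #|labs S (vend S)|.
Proof.
move=> vS pk; have := deg_end vS; have := bin_pred_le; rewrite pk.
have r2 := r_gt2; clear -r2 rk; lia.
Qed.

Lemma deg_beg_pred S : valid S -> #|nR S| = k.-1 -> k <= #|labs S (vbeg S)|.
Proof.
move=> vS pk; have := deg_beg vS; have := bin_pred_le; rewrite pk.
have r2 := r_gt2; clear -r2 rk; lia.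
Qed.

(** A rotation through a label keeps [nR S], and the size of the other side must again be [k.-1]; so
    each new last vertex lies in at least [k] labels, and [k + k.-1 = m] is what [tie_false] asks
    for. *)
Lemma tie_even S : valid S -> m.+1 = k.*2 -> #|nL S| = k.-1 -> #|nR S| = k.-1 ->
  False.
Proof.
move=> vS mE pk qk; have r2 := r_gt2.
apply: (tie_false vS).
  exact: leq_trans rk (deg_end_pred vS pk).
move=> l lm ls al; have [vS' frS' eS'] := rotU vS lm ls al.
have qk' : #|nR (rot S l (lb S l))| = k.-1 by rewrite frS'.
have n0 : 0 < #|nL (rot S l (lb S l))| + #|nR (rot S l (lb S l))|.
  by rewrite qk'; clear -r2 rk; lia.
have pk' : #|nL (rot S l (lb S l))| = k.-1.
  move: (nb_sizes_valid vS' n0); rewrite qk' /nb_sizes.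
  move: #|nL (rot _ _ _)| => p; clear -r2 rk mE; lia.
have := deg_end_pred vS' pk'; rewrite eS' qk; clear -mE; lia.
Qed.

Lemma tie_odd S : valid S -> m = k.*2 -> #|nL S| = k.-1 -> #|nR S| = k -> False.
Proof.
move=> vS mE pk qk; have r2 := r_gt2.
apply: (tie_false vS).
  exact: leq_trans rk (deg_end_pred vS pk).
move=> l lm ls al; have [vS' frS' eS'] := rotU vS lm ls al.
have qk' : #|nR (rot S l (lb S l))| = k by rewrite frS'.
have [pk'|[pk' _]] := ends_k mE vS' qk'.
  by case: (both_k_false mE vS' pk' qk').
have := deg_end_pred vS' pk'; rewrite eS' qk; clear -mE; lia.
Qed.

Lemma tie_odd_beg S : valid S -> m = k.*2 -> #|nL S| = k -> #|nR S| = k.-1 -> False.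
Proof.
move=> vS mE pk qk; apply: (tie_odd (mir_valid vS) mE);
by rewrite ?mir_vend ?mir_vbeg mir_fr.
Qed.

(* The [m - 1] labels have one vertex each besides the two that they link. *)
Lemma sum_labs3 S (X : {set V}) : valid S -> r = 3 -> vbeg S \in X -> vend S \in X ->
  \sum_(v in X) #|labs S v| + 2 <= m.-1 + 2 * #|X|.
Proof.
move=> vS r3 bX aX; have sm := sp_lt vS.
have cL : \sum_(j < m) (vx S j \in X) = #|X|.-1.
  have -> : #|X|.-1 = #|X :\ vend S| by have := cardsD1 (vend S) X; rewrite aX => ->.
  rewrite -(card_pos vS (A := X :\ vend S)); last by rewrite in_setD1 eqxx.
  rewrite -sum1_card [RHS]big_mkcond /=; apply: eq_bigr => j _.
  by rewrite inE in_setD1 /vend (vx_eq vS) // 1?ltnW // ltn_eqF //=.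
have cR : \sum_(j < m) (vx S j.+1 \in X) = #|X|.-1.
  have -> : #|X|.-1 = #|X :\ vbeg S| by have := cardsD1 (vbeg S) X; rewrite bX => ->.
  rewrite -(card_pos1 vS (A := X :\ vbeg S)); last by rewrite in_setD1 eqxx.
  rewrite -sum1_card [RHS]big_mkcond /=; apply: eq_bigr => j _.
  by rewrite inE in_setD1 /vbeg (vx_eq vS) //=; case: (_ \in X).
have one (j : 'I_m) : nat_of_ord j != sp S ->
    #|X :&: lb S j| <= (vx S j \in X) + (vx S j.+1 \in X) + 1.
  move=> js; have jm := ltn_ord j; have /andP[j0 j1] := lb_vx vS jm.
  have j01 : vx S j.+1 != vx S j by rewrite (vx_eq vS) ?gtn_eqF // ltnW.
  have cj := lb_card vS jm js.
  rewrite (cardsD1 (vx S j)) (cardsD1 (vx S j.+1)) in_setI j0 andbT.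
  rewrite in_setD1 in_setI j01 j1 andbT addnA leq_add2l.
  apply: leq_trans (subset_leq_card (_ : _ \subset lb S j :\ vx S j :\ vx S j.+1)) _.
    by rewrite !setSD // subsetIr.
  have := cardsD1 (vx S j) (lb S j).
  have := cardsD1 (vx S j.+1) (lb S j :\ vx S j).
  by rewrite in_setD1 j01 j0 j1 cj r3; clear; lia.
have -> : \sum_(v in X) #|labs S v| = \sum_(j < m | nat_of_ord j != sp S) #|X :&: lb S j|.
  transitivity (\sum_(v in X) \sum_(j < m | nat_of_ord j != sp S) (v \in lb S j : nat)).
    apply: eq_bigr => v _; rewrite -sum1_card big_mkcond [RHS]big_mkcond /=.
    by apply: eq_bigr => j _; rewrite in_labs; case: (nat_of_ord j != sp S) => //=.
  rewrite exchange_big /=; apply: eq_bigr => j _.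
  rewrite -sum1_card big_mkcond [RHS]big_mkcond /=.
  by apply: eq_bigr => v _; rewrite in_setI; case: (v \in X).
have X0 : 0 < #|X| by apply/card_gt0P; exists (vbeg S).
have le1 : \sum_(j < m | nat_of_ord j != sp S) #|X :&: lb S j| <=
    \sum_(j < m | nat_of_ord j != sp S) ((vx S j \in X) + (vx S j.+1 \in X) + 1).
  by apply: leq_sum => j; apply: one.
have le2 : \sum_(j < m | nat_of_ord j != sp S) ((vx S j \in X) + (vx S j.+1 \in X)) <=
    \sum_(j < m) ((vx S j \in X) + (vx S j.+1 \in X)).
  by rewrite [leqRHS](bigID (fun j : 'I_m => nat_of_ord j != sp S)) leq_addr.
have c1 : \sum_(j < m | nat_of_ord j != sp S) 1 = m.-1.
  rewrite sum1_card; have := cardC1 (Ordinal sm); rewrite card_ord => <-.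
  by apply: eq_card => j; rewrite !inE -val_eqE.
rewrite big_split /= c1 in le1; rewrite [leqRHS]big_split /= cL cR in le2.
have := leq_trans le1 (leq_add le2 (leqnn _)); rewrite -(leq_add2r 2).
by move/leq_trans; apply; move: X0; clear; lia.
Qed.

(** Every state with this [nR] has its last vertex in at least [k] labels, and the rotations through
    labels do not change the number of labels at a vertex. This gives more than [k] vertices in [k]
    labels each, too many for [sum_labs3]. *)
Lemma r3_false S : valid S -> r = 3 -> m = k.*2 -> #|nR S| = k.-1 -> False.
Proof.
move=> vS r3 mE qk; have r2 := r_gt2.
have many S' : valid S' -> #|nR S'| = k.-1 -> k <= #|labs S' (vend S')|.
  move=> vS' qk'; have n0 : 0 < #|nL S'| + #|nR S'| by rewrite qk'; clear -r2 rk; lia.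
  have := nb_sizes_valid vS' n0; rewrite qk' => FT.
  have [pk|[pk|p0]] : #|nL S'| = k.-1 \/ #|nL S'| = k \/ #|nL S'| = 0.
  - move: FT; rewrite /nb_sizes; move: #|nL S'| => p; clear -r2 rk mE; lia.
  - exact: deg_end_pred.
  - by case: (tie_odd_beg vS' mE pk qk').
  have := deg_end vS'; rewrite p0.
  have -> : 'C(0, r.-1) = 0 by rewrite bin_small //; clear -r2; lia.
  have := bin_pred_le; clear -r2 rk; lia.
pose T := [set vx S l.+1 | l : 'I_m in labs S (vend S)].
pose X := vbeg S |: (vend S |: T).
have ab := end_neq_beg vS.
have cT : #|T| = #|labs S (vend S)|.
  rewrite card_in_imset // => i j _ _ /(vx_inj vS) E; apply: val_inj => /=.
  by have /(_ _ _)/eq_add_S := E; apply.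
have cX : k < #|X|.
  rewrite cardsU1; have -> : vbeg S \notin vend S |: T.
    rewrite in_setU1 negb_or eq_sym ab /=; apply/imsetP => -[j _ /eqP].
    by rewrite /vbeg (vx_eq vS).
  have := many S vS qk; rewrite -cT => kT; rewrite add1n ltnS (leq_trans kT) //.
  by apply/subset_leq_card/subsetUr.
have big v : v \in X -> k <= #|labs S v|.
  rewrite !in_setU1 => /or3P[/eqP->|/eqP->|/imsetP[l]].
  - exact: deg_beg_pred.
  - exact: many.
  rewrite in_labs => /andP[ls al] ->.
  have [vS' frS' eS'] := rotU vS (ltn_ord l) ls al.
  have := many _ vS'; rewrite frS' => /(_ qk).
  have := deg_split vS' (vx S l.+1); rewrite (deg_split vS) frS' eS'.
  by move/addnI => ->.
have := sum_labs3 vS r3 (X := X); rewrite !in_setU1 !eqxx orbT => /(_ isT isT).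
have : #|X| * k <= \sum_(v in X) #|labs S v|.
  by rewrite -sum_nat_const; apply: leq_sum => v; apply: big.
move: #|X| cX (\sum_(v in X) _) => t kt s; clear -r2 rk mE kt; nia.
Qed.

(** Each end would lie in at least 6 labels, while [sum_labs3] allows 9 in total. *)
Lemma order_nine_false S : valid S -> m = k.*2 -> k = 4 -> r = 3 -> #|nL S| = 2 ->
  #|nR S| = 2 -> False.
Proof.
move=> vS mE k4 r3 p2 q2.
have := deg_end vS; have := deg_beg vS.
rewrite k4 r3 p2 q2 /= => lb_ la.
have := sum_labs3 vS r3 (X := [set vbeg S; vend S]).
have ab := end_neq_beg vS.
rewrite !inE !eqxx orbT => /(_ isT isT).
rewrite big_setU1 /=; last by rewrite inE eq_sym.
rewrite big_set1 cards2 [vbeg S == _]eq_sym ab => le2.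
have C4 : 'C(4, 2) = 6 by []. have C2 : 'C(2, 2) = 1 by [].
rewrite C4 C2 in la lb_; clear -la lb_ le2 mE k4; lia.
Qed.

(** * Odd order with r = k *)

Section MaximalUniformity.

Hypothesis mE : m = k.*2.
Hypothesis rE : r = k.
Hypothesis k4 : 3 < k.

Lemma bin_rE : 'C(k, r.-1) = k.
Proof. by rewrite rE; case: (k) k4 => // k' _; exact: binSn. Qed.

Lemma nL_pred S : valid S -> #|nR S| = k.-1 -> #|nL S| = k.-1.
Proof.
move=> vS qk; have n0 : 0 < #|nL S| + #|nR S| by rewrite qk; clear -k4; lia.
have := nb_sizes_valid vS n0; rewrite qk => FT.
have [//|[pk|p0]] : #|nL S| = k.-1 \/ #|nL S| = k \/ #|nL S| = 0.
- by move: FT; rewrite /nb_sizes; move: #|nL S| => p; clear -k4 rE mE; lia.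
- by case: (tie_odd_beg vS mE pk qk).
exfalso; apply: (one_free_false vS p0); try by clear -rE mE k4 qk; lia.
move=> v; have := degH v; rewrite bin_rE.
by clear -rE mE; lia.
Qed.

Lemma pred_lt_r (A : {set V}) : #|A| = k.-1 -> #|A| < r.
Proof. by move=> ->; rewrite rE; clear -k4; lia. Qed.

Lemma pred_uniq S e f : valid S -> #|nR S| = k.-1 -> e \in fr S -> f \in fr S ->
  vend S \in e -> vend S \in f -> e = f.
Proof. by move=> vS /(nL_pred vS)/pred_lt_r pk; apply: (fe_uniq vS pk). Qed.

Lemma pred_ex S : valid S -> #|nR S| = k.-1 ->
  exists2 e, e \in fr S & vend S \in e.
Proof.
move=> vS /(nL_pred vS) pk.
have /card_gt0P[u /nbP[_ [e eF [_ ae]]]] : 0 < #|nL S| by rewrite pk; clear -k4; lia.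
by exists e.
Qed.

(** After the rotation through the label at [l], the new last vertex lies in some free edge [f].
    After the rotation with [e] it lies in the freed label and, if [f] is not [e], also in [f],
    against uniqueness. So [f = e]. *)
Lemma run_closed S e (l : 'I_m) : valid S -> #|nR S| = k.-1 -> e \in fr S ->
  vend S \in e -> l \in JL S :&: labs S (vend S) -> vx S l.+1 \in e.
Proof.
move=> vS qk eF ae; rewrite in_setI in_JL in_labs => /andP[lL /andP[ls al]].
have lm := ltn_ord l; have pk := pred_lt_r (nL_pred vS qk).
have le : vx S l \in e by move: lL; rewrite (nLE vS pk eF ae) in_setD1 => /andP[].
have [vS2 frS2 eS2] := rotU vS lm ls al.
have [vS1 frS1 eS1] := rotF vS lm ls eF le ae.
have qk2 : #|nR (rot S l (lb S l))| = k.-1 by rewrite frS2.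
have qk1 : #|nR (rot S l e)| = k.-1 by rewrite (rotF_nR vS lm ls eF le ae).
have [f] := pred_ex vS2 qk2; rewrite frS2 eS2 => fF l1f.
have [<- //|fe_] := eqVneq f e.
have := fr_lb fF lm => /eqP[]; apply: (pred_uniq vS1 qk1).
- by rewrite frS1 setU11.
- by rewrite frS1 in_setU1 in_setD1 fe_ fF orbT.
- by rewrite eS1; case/andP: (lb_vx vS lm).
- by rewrite eS1.
Qed.

(** [JL S] and the labels through the last vertex meet [JR S] in [sp S] at most, so their union has
    at most [k + 2] positions, while their sizes are [k.-1] and at least [k]. *)
Lemma run_card S : valid S -> #|nR S| = k.-1 ->
  k - 3 <= #|JL S :&: labs S (vend S)|.
Proof.
move=> vS qk; have pk := nL_pred vS qk.
have lk := deg_end_pred vS pk; have sm := sp_lt vS.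
have : (JL S :|: labs S (vend S)) :&: JR S \subset [set Ordinal sm].
  apply/subsetP => i; rewrite in_setI in_setU in_set1 -val_eqE /= => /andP[/orP[iL|]].
    by move=> iR; rewrite (JLR_sub vS iL iR).
  rewrite in_labs in_JR => /andP[is_ ai] iR.
  by case: (crossUR vS (ltn_ord i) is_ ai iR).
move/subset_leq_card; rewrite cards1.
have := cardsUI (JL S :|: labs S (vend S)) (JR S).
have := cardsUI (JL S) (labs S (vend S)).
have := max_card (JL S :|: labs S (vend S) :|: JR S); rewrite card_ord.
rewrite (card_JL vS) (card_JR vS) pk qk.
by clear -lk mE; lia.
Qed.

(** All degrees are at least [k.+1], so [H] has at least [2k + 4] edges, of which at most [2k - 1]
    are labels. *)
Lemma card_free S : valid S -> 4 < #|fr S|.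
Proof.
move=> vS; have cL := card_H_le vS.
have : m.+1 * k.+1 <= r * #|H|.
  rewrite -(degree_sum uH) -cardV -sum_nat_const; apply: leq_sum => v _.
  by have := degH v; rewrite bin_rE addn1.
have {}cL : #|H| <= #|fr S| + k.*2.-1 by rewrite -mE.
have -> : m.+1 * k.+1 = k.*2.+1 * k.+1 by rewrite -mE.
rewrite rE => le1.
have : k * #|H| <= k * (#|fr S| + k.*2.-1) by rewrite leq_mul2l cL orbT.
move: #|fr S| #|H| le1 => f h le1 le2.
by clear -le1 le2 k4; nia.
Qed.

(** * The last vertices reachable with the same first vertex and free edges *)

Section Ends.

Variables (S0 : state V) (fb : {set V}) (X : {set V}).
Hypotheses (vS0 : valid S0) (q0 : #|nR S0| = k.-1).
Hypotheses (fbF : fb \in fr S0) (b_fb : vbeg S0 \in fb).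
(** A hypothesis and not a definition, since being reached by some state is not a boolean condition;
    [r_eq_k_false] supplies [X]. *)
Hypothesis XP : forall c, c \in X <->
  exists S, [/\ valid S, vbeg S = vbeg S0, fr S = fr S0 & vend S = c].

Lemma ends_q S : vbeg S = vbeg S0 -> fr S = fr S0 -> #|nR S| = k.-1.
Proof. by move=> -> ->. Qed.

Lemma ends_notin : X \subset ~: fb.
Proof.
apply/subsetP => c /XP[S [vS bS frS <-]]; rewrite in_setC; apply/negP => cf.
by apply: (no_closing vS (e := fb)); rewrite ?frS ?bS.
Qed.

Lemma ends_rot S l : valid S -> vbeg S = vbeg S0 -> fr S = fr S0 -> l < m ->
  l != sp S -> vend S \in lb S l -> vx S l.+1 \in X.
Proof.
move=> vS bS frS lm ls al; have [vS' frS' eS'] := rotU vS lm ls al.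
by apply/XP; exists (rot S l (lb S l)); rewrite rot_vbeg frS'.
Qed.

Lemma ends_free c : c \in X -> #|fe (fr S0) c| = 1.
Proof.
case/XP => S [vS bS frS <-]; have qk := ends_q bS frS.
have [e eF ae] := pred_ex vS qk.
apply/eqP/cards1P; exists e; apply/setP => f; rewrite in_fe in_set1 -frS.
apply/andP/eqP => [[fF af]|->]; last by split.
exact: (pred_uniq vS qk).
Qed.

Lemma ends_card : k <= #|X| <= k.+1.
Proof.
apply/andP; split.
  have lk := deg_end_pred vS0 (nL_pred vS0 q0).
  apply: leq_trans lk _.
  rewrite -(card_in_imset (f := fun j : 'I_m => vx S0 j.+1)); last first.
    move=> i j _ _ /(vx_inj vS0) E; apply: val_inj => /=.
    by have /(_ _ _)/eq_add_S := E; apply.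
  apply/subset_leq_card/subsetP => u /imsetP[l]; rewrite in_labs => /andP[ls al] ->.
  exact: (ends_rot vS0 erefl erefl (ltn_ord l) ls al).
apply: leq_trans (subset_leq_card ends_notin) _.
have := cardsC fb; rewrite (fr_card vS0 fbF) cardV rE mE; clear -k4; lia.
Qed.

Lemma ends_run e : e \in fr S0 -> e :&: X != set0 -> k - 3 <= #|e :&: X|.
Proof.
move=> eF /set0Pn[c]; rewrite in_setI => /andP[ce /XP[S [vS bS frS cE]]].
have qk := ends_q bS frS; apply: leq_trans (run_card vS qk) _.
rewrite -(card_in_imset (f := fun j : 'I_m => vx S j.+1)); last first.
  move=> i j _ _ /(vx_inj vS) E; apply: val_inj => /=.
  by have /(_ _ _)/eq_add_S := E; apply.
apply/subset_leq_card/subsetP => u /imsetP[l lI ->]; rewrite in_setI.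
rewrite (run_closed vS qk _ _ lI) ?frS ?cE //=.
move: lI; rewrite in_setI in_labs => /andP[_ /andP[ls al]].
exact: (ends_rot vS bS frS (ltn_ord l) ls al).
Qed.

Lemma other_edges e : e \in fr S0 -> e != fb -> vbeg S0 \notin e.
Proof.
move=> eF efb; apply: contra efb => be; apply/eqP.
have q1 : #|nb (fr S0) (vbeg S0)| < r by apply: pred_lt_r.
exact: (fe_uniq vS0 q1 eF fbF be b_fb).
Qed.

Let F' := fr S0 :\ fb.
Let F1 := [set e in F' | e :&: X != set0].

Lemma ends_sum : \sum_(e in F1) #|e :&: X| = #|X|.
Proof.
have -> : \sum_(e in F1) #|e :&: X| = \sum_(e in fr S0) #|e :&: X|.
  rewrite big_mkcond [RHS]big_mkcond /=; apply: eq_bigr => e _.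
  rewrite inE in_setD1; have [->|efb] := eqVneq e fb.
    have -> : fb :&: X = set0; last by rewrite cards0; case: ifP.
    apply/setP => c; rewrite in_setI in_set0; apply/negP => /andP[cf cX].
    by have /subsetP/(_ c cX) := ends_notin; rewrite in_setC cf.
  case: (e \in fr S0) => //=; case: eqP => // ->; by rewrite cards0.
have -> : \sum_(e in fr S0) #|e :&: X| = \sum_(e in fr S0) \sum_(c in X) (c \in e : nat).
  apply: eq_bigr => e _; rewrite -sum1_card big_mkcond [RHS]big_mkcond /=.
  by apply: eq_bigr => c _; rewrite in_setI andbC; case: (c \in X).
rewrite exchange_big /= -sum1_card; apply: eq_bigr => c cX.
rewrite -(ends_free cX) -sum1_card big_mkcond [RHS]big_mkcond /=.
by apply: eq_bigr => e _; rewrite in_fe; case: (e \in fr S0).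
Qed.

(* Only the edge made of [fb], without its first vertex, and of the one vertex
   outside [fb] and [X] can miss [X]. *)
Lemma ends_meet : #|X| + 2 < #|F1| + k.
Proof.
have c4 : 3 < #|F'|.
  by have := card_free vS0; rewrite (cardsD1 fb) fbF.
have cC : #|~: fb| = k.+1.
  have := cardsC fb; rewrite (fr_card vS0 fbF) cardV rE mE; clear -k4; lia.
have /andP[X1 X2] := ends_card.
have miss e : e \in F' :\: F1 -> e :&: X = set0 /\ e \in F'.
  rewrite in_setD inE => /andP[+ eF]; rewrite eF /= negbK => /eqP ->.
  by split.
have outX e : e \in F' -> exists2 c, c \in e & c \notin fb.
  rewrite in_setD1 => /andP[efb eF]; apply/subsetPn.
  apply: contra efb => sub; rewrite eqEcard sub.
  by rewrite (fr_card vS0 eF) (fr_card vS0 fbF) leqnn.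
have := cardsID F1 F'; have -> : F' :&: F1 = F1.
  by apply/setIidPr/subsetP => e; rewrite inE => /andP[].
have [XE|XN] := eqVneq #|X| k.+1.
  have XfE : X = ~: fb by apply/eqP; rewrite eqEcard ends_notin cC XE leqnn.
  have -> : F' :\: F1 = set0.
    apply/setP => e; rewrite in_set0; apply/negP => /miss[e0 eF].
    have [c ce cf] := outX e eF.
    have : c \in e :&: X by rewrite in_setI ce XfE in_setC.
    by rewrite e0 in_set0.
  by rewrite cards0 XE; clear -c4; lia.
have {XN} XE : #|X| = k by clear -X1 X2 XN; lia.
have /cards1P[t tE] : #|~: fb :\: X| == 1.
  have := cardsID X (~: fb); rewrite cC (setIidPr ends_notin) XE.
  by move=> E; apply/eqP; clear -E; lia.
have le1 : #|F' :\: F1| <= 1.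
  have h e : e \in F' :\: F1 -> e = t |: (fb :\ vbeg S0).
    move=> /miss[e0 eF]; have [efb eF0] : e != fb /\ e \in fr S0.
      by move: eF; rewrite in_setD1 => /andP[].
    have be := other_edges eF0 efb.
    have sub : e \subset t |: (fb :\ vbeg S0).
      apply/subsetP => u ue; rewrite in_setU1 in_setD1.
      have -> : u != vbeg S0 by apply: contraNneq be => <-.
      have [uf|uf] := boolP (u \in fb); first by rewrite orbT.
      have : u \in ~: fb :\: X.
        rewrite in_setD in_setC uf andbT; apply/negP => uX.
        by have := in_setI u e X; rewrite e0 in_set0 ue uX.
      by rewrite tE in_set1 => ->.
    apply/eqP; rewrite eqEcard sub (fr_card vS0 eF0) cardsU1.
    have := cardsD1 (vbeg S0) fb; rewrite b_fb (fr_card vS0 fbF) => ->.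
    by rewrite leq_add2r leq_b1.
  by apply/card_le1_eqP => e f /h -> /h ->.
by move: le1 c4; rewrite XE; clear; lia.
Qed.

(** By [ends_sum] the free edges that meet [X] partition it, and by [ends_meet] they are too many
    for each to meet [X] in both 2 and [k - 3] vertices. With [ends_run] this leaves one vertex and
    [k = 4]. *)
Lemma ends_small : k = 4 /\ exists2 e, e \in F' & #|e :&: X| = 1.
Proof.
have sumE := ends_sum; have meet := ends_meet; have /andP[X1 X2] := ends_card.
have [e eF1 le] : exists2 e, e \in F1 & #|e :&: X| < maxn 2 (k - 3).
  apply/exists_inP; apply: contraT; rewrite negb_exists_in => /forall_inP h.
  exfalso; have : #|F1| * maxn 2 (k - 3) <= \sum_(e in F1) #|e :&: X|.
    by rewrite -sum_nat_const; apply: leq_sum => e eF; rewrite leqNgt h.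
  rewrite sumE; move: #|F1| #|X| meet X1 X2 => f c meet X1 X2.
  by clear -meet X1 X2 k4; move: (leq_maxl 2 (k - 3)) (leq_maxr 2 (k - 3));
    move: (maxn _ _) => w w1 w2; nia.
move: eF1; rewrite inE => /andP[eF e0].
have := ends_run (subsetP (subsetDl _ _) _ eF) e0.
have c0 : 0 < #|e :&: X| by rewrite card_gt0.
move=> le2; have kE : k = 4 by clear -le le2 k4 c0; lia.
by split=> //; exists e => //; clear -kE le c0; lia.
Qed.

(** Let [c], the only vertex of [X] in [e], be the last vertex. Then [run_closed] leaves the last
    position as the only one in [JL S] whose label contains [c], and the same holds after the last
    label [e'] is exchanged for [e]. Counting determines the rest of [JL] in both states, so [c] has
    the same free neighbours in both, and [e' = e]. *)
Lemma ends_false : False.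
Proof.
have [kE [e]] := ends_small; rewrite in_setD1 => /andP[efb eF] cI.
have /eqP/cards1P[c cE] := cI.
have [ce cX] : c \in e /\ c \in X.
  by apply/andP; rewrite -in_setI cE in_set1.
have [S [vS bS frS aS]] := (XP c).1 cX.
have qk := ends_q bS frS; have pk := nL_pred vS qk.
have eS : e \in fr S by rewrite frS.
have ae : vend S \in e by rewrite aS.
have sm := sp_lt vS.
have lm : m.-1 < m by clear -sm; lia.
have l1 : m.-1.+1 = m by clear -sm; lia.
pose L := Ordinal lm.
have JLE (S' : state V) e' : valid S' -> #|nR S'| = k.-1 -> e' \in fr S' ->
    vend S' \in e' -> JL S' :&: labs S' (vend S') \subset [set L] ->
    JL S' :&: labs S' (vend S') = [set L].
  move=> vS' qk' _ _ sub; apply/eqP; rewrite eqEcard sub cards1.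
  by have := run_card vS' qk'; rewrite kE.
have subS : JL S :&: labs S (vend S) \subset [set L].
  apply/subsetP => l lI; have l1e := run_closed vS qk eS ae lI.
  move: (lI); rewrite in_setI in_labs => /andP[_ /andP[ls al]].
  have l1X := ends_rot vS bS frS (ltn_ord l) ls al.
  have : vx S l.+1 \in e :&: X by rewrite in_setI l1e.
  rewrite cE in_set1 in_set1 -aS /vend (vx_eq vS) // -val_eqE /=.
  by clear -l1; lia.
have JLS := JLE S e vS qk eS ae subS.
have : L \in JL S :&: labs S (vend S) by rewrite JLS in_set1.
rewrite in_setI in_labs in_JL /= => /andP[LL /andP[Ls La]].
have pr := pred_lt_r pk.
have Le : vx S m.-1 \in e by move: LL; rewrite (nLE vS pr eS ae) in_setD1 => /andP[].
have L1e : vx S m.-1.+1 \in e by rewrite l1.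
have be : vbeg S \notin e by apply/negP => be; apply: (no_closing vS eS be ae).
have bL : vbeg S \notin lb S m.-1 by apply/negP; apply: (crossLU vS lm Ls LL).
have [vS3 frS3] := swpF vS lm Ls eS Le L1e.
have nR3 := swpF_nR vS lm Ls eS Le L1e be bL.
have qk3 : #|nR (swp S m.-1 e)| = k.-1 by rewrite nR3.
have pk3 := nL_pred vS3 qk3; have pr3 := pred_lt_r pk3.
set e' := lb S m.-1 in La frS3.
have e'F : e' \in fr (swp S m.-1 e) by rewrite frS3 setU11.
have ae' : vend (swp S m.-1 e) \in e' by [].
have labs3 : labs (swp S m.-1 e) (vend (swp S m.-1 e)) = labs S (vend S).
  apply/setP => j; rewrite !in_labs /=.
  have [jl|//] := eqVneq (j : nat) m.-1; rewrite jl.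
  by rewrite (_ : vend (swp S m.-1 e) \in e) // La.
have e'N : e' \notin fr S by apply/negP => e'S; have := fr_lb e'S lm; rewrite eqxx.
have sub3 : JL (swp S m.-1 e) :&: labs (swp S m.-1 e) (vend (swp S m.-1 e)) \subset [set L].
  apply/subsetP => l lI; have l1e := run_closed vS3 qk3 e'F ae' lI.
  have l3 : l \in labs (swp S m.-1 e) (vend (swp S m.-1 e)).
    by move: lI; rewrite in_setI => /andP[].
  rewrite in_set1 -val_eqE /=; apply: contraT => lL; exfalso.
  move: (l3); rewrite labs3 in_labs => /andP[ls al].
  move: (l3); rewrite in_labs => /andP[ls3 al3].
  have lm' := ltn_ord l.
  have v_X := ends_rot vS bS frS lm' ls al.
  have [vS4 frS4 eS4] := rotU vS3 lm' ls3 al3.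
  have /eqP/cards1P[f fE] := ends_free v_X.
  have : f \in fe (fr S0) (vx S l.+1) by rewrite fE in_set1.
  rewrite in_fe -frS => /andP[fF vf].
  have vc : vx S l.+1 != c.
    by rewrite -aS /vend (vx_eq vS) //; move: lL; clear -l1; lia.
  have fe_ : f != e.
    apply: contraNneq vc => fe_; have : vx S l.+1 \in e :&: X.
      by rewrite in_setI v_X -fe_ vf.
    by rewrite cE in_set1.
  have qk4 : #|nR (rot (swp S m.-1 e) l (lb (swp S m.-1 e) l))| = k.-1.
    by rewrite frS4.
  have fe' : f = e'.
    apply: (pred_uniq vS4 qk4); rewrite ?frS4 ?eS4 //.
    by rewrite frS3 in_setU1 in_setD1 fe_ fF orbT.
  by rewrite -fe' fF in e'N.
have JLS3 := JLE _ e' vS3 qk3 e'F ae' sub3.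
have lk := deg_end_pred vS pk.
(* Every free neighbour of the last vertex whose position has a label avoiding that vertex, or is
   [sp S], is at a position of [Y]; there are exactly two such positions, so [Y] is filled. *)
pose Y := (Ordinal sm |: ~: JR S) :\: labs S (vend S).
have cY : #|Y| <= 2.
  have sub : labs S (vend S) \subset ~: JR S.
    apply/subsetP => j; rewrite in_labs in_setC in_JR => /andP[js aj].
    by apply/negP; apply: (crossUR vS (ltn_ord j) js aj).
  have := cardsID (labs S (vend S)) (Ordinal sm |: ~: JR S).
  rewrite (setIidPr (subset_trans sub (subsetUr _ _))).
  have := cardsC (JR S); rewrite card_ord (card_JR vS) qk.
  have := cardsU1 (Ordinal sm) (~: JR S); have := leq_b1 (Ordinal sm \notin ~: JR S).
  by rewrite /Y; clear -lk kE mE; lia.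
have YE (S' : state V) : valid S' -> sp S' = sp S -> nR S' = nR S -> vx S' =1 vx S ->
    labs S' (vend S') = labs S (vend S) -> #|nL S'| = k.-1 ->
    JL S' :&: labs S' (vend S') = [set L] -> JL S' = L |: Y.
  move=> vS' sS' nS' vxS' lS' pS' JS'.
  have sub : JL S' :\: labs S (vend S) \subset Y.
    apply/setSD/subsetP => j jL; rewrite in_setU1 in_setC -val_eqE /=.
    have [//|js] := eqVneq (j : nat) (sp S); rewrite /=; apply/negP => jR.
    have jR' : j \in JR S' by rewrite in_JR nS' vxS' -in_JR.
    by move: js; rewrite (JLR_sub vS' jL jR') sS' eqxx.
  have cD := cardsID (labs S (vend S)) (JL S').
  rewrite -{1}lS' JS' cards1 (card_JL vS') pS' kE in cD.
  have {}YE : JL S' :\: labs S (vend S) = Y.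
    by apply/eqP; rewrite eqEcard sub (leq_trans cY) //; clear -cD; lia.
  by rewrite -(setID (JL S') (labs S (vend S))) -{1}lS' JS' YE.
have E1 := YE S vS erefl erefl (fun _ => erefl) erefl pk JLS.
have E3 := YE _ vS3 erefl nR3 (fun _ => erefl) labs3 pk3 JLS3.
case/negP: e'N; suff -> : e' = e by [].
apply: (edge_eqD1 (fr_edge e'F) (fr_edge eS) ae).
rewrite -(nLE vS pr eS ae); apply/subsetP => u; rewrite in_setD1 => /andP[ua ue'].
have [j jm ju] := vx_onto_end vS ua.
have : Ordinal jm \in JL (swp S m.-1 e).
  by rewrite in_JL (nLE vS3 pr3 e'F ae') in_setD1 /= ju ue' andbT.
by rewrite E3 -E1 in_JL /= ju.
Qed.

End Ends.

Lemma r_eq_k_false S0 : valid S0 -> #|nR S0| = k.-1 -> False.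
Proof.
move=> vS0 q0.
have /card_gt0P[u /nbP[_ [fb fbF [_ bf]]]] : 0 < #|nR S0| by rewrite q0; clear -k4; lia.
pose reach c := exists S, [/\ valid S, vbeg S = vbeg S0, fr S = fr S0 & vend S = c].
(* As the goal is [False], [X] can be grown: a set of reachable vertices either is complete or
   misses a reachable vertex that can be added. *)
suff no n (X : {set V}) : (forall c, c \in X -> reach c) -> #|~: X| <= n -> False.
  by apply: (no #|V| set0); [move=> c; rewrite in_set0 | apply: max_card].
elim: n X => [|n IH] X XR cX.
  apply: (ends_false vS0 q0 fbF bf (X := X)) => c; split; first exact: XR.
  move=> _; have := cX; rewrite leqn0 cards_eq0 => /eqP/setP/(_ c).
  by rewrite in_setC in_set0 => /negbFE.
apply: (ends_false vS0 q0 fbF bf (X := X)) => c; split; first exact: XR.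
move=> rc; apply: contraT => cN; exfalso; apply: (IH (c |: X)).
  by move=> c'; rewrite in_setU1 => /orP[/eqP->|/XR].
have : ~: (c |: X) \proper ~: X.
  by rewrite properEneq setCS subsetUr andbT; apply: contraNneq cN => /setC_inj <-; rewrite setU11.
by move/proper_card; move: cX; clear; lia.
Qed.

End MaximalUniformity.

Lemma beg_pred_false S : valid S -> m = k.*2 -> r = 3 \/ r = k -> #|nR S| = k.-1 ->
  False.
Proof.
move=> vS mE r3k qk; have r2 := r_gt2.
have [r3|r3] := eqVneq r 3; first exact: (r3_false vS r3 mE qk).
have rE : r = k by case: r3k => // /eqP; rewrite (negPf r3).
apply: (r_eq_k_false mE rE _ vS qk).
by move: r3; clear -rE r2; lia.
Qed.

Lemma end_pred_false S : valid S -> m = k.*2 -> r = 3 \/ r = k -> #|nL S| = k.-1 ->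
  False.
Proof.
move=> vS mE r3k pk; apply: (beg_pred_false (mir_valid vS) mE r3k).
by rewrite mir_fr mir_vbeg.
Qed.

Lemma small_r_false S : valid S -> fr S != set0 -> False.
Proof.
move=> vS0 F0; have r2 := r_gt2.
have [S1 vS n1] : exists2 S', valid S' & 0 < #|nL S'| + #|nR S'|.
  apply: (ex_end_in_free vS0 F0) => v; have := degH v.
  have [rE|rE] := eqVneq r k.
    have : k <= 'C(k, r.-1) by apply: bin_ge_upper; clear -r2 rk; lia.
    by move: 'C(_, _) => c; clear -r2 mk rE; lia.
  have : k.*2 <= 'C(k, r.-1) + 2.
    by apply: bin_ge_double; move: rE; clear -r2 rk; lia.
  by move: 'C(_, _) => c; clear -r2 mk; lia.
have := nb_sizes_valid vS n1.
case=> [[mE [[pk qk]|[pk qk]]]|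
        [[mE [[pk qk]|[[pk qk]|[pk qk]]]]|
        [[mE [r3k [[pk qk]|[[pk qk]|[pk qk]]]]]|
        [[mE [rE [[pk qk]|[pk qk]]]]|
         [mE [kE [rE [pk qk]]]]]]]].
- by apply: (tight_k vS pk); rewrite pk qk mE addnn.
- exact: (tie_even vS mE pk qk).
- by apply: (tight_k vS pk); rewrite pk qk mE addnS addnn.
- by apply: (tight_k_beg vS qk); rewrite pk qk mE addSn addnn.
- exact: (both_k_false mE vS pk qk).
- exact: (tie_odd vS mE pk qk).
- exact: (tie_odd_beg vS mE pk qk).
- exact: (beg_pred_false vS mE r3k qk).
- by apply: (beg_pred_false vS mE _ qk); right.
- by apply: (end_pred_false vS mE _ pk); right.
- exact: (order_nine_false vS mE kE rE pk qk).
Qed.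

End SmallUniformity.

End Stuck.

(** * Adding edges until a spanning path exists *)

Section SpanningPath.

Variables (V : finType) (x y : V) (m r : nat).
Implicit Types (H : {set {set V}}) (e : {set V}) (S : state V).

Record spanning_path H (z : nat -> V) (l : nat -> {set V}) : Prop := SpanningPath {
  path_inj : forall i j, i <= m -> j <= m -> z i = z j -> i = j;
  path_beg : z 0 = x;
  path_end : z m = y;
  path_lb_inj : forall i j, i < m -> j < m -> l i = l j -> i = j;
  path_edge : forall j, j < m -> l j \in H;
  path_in : forall j, j < m -> (z j \in l j) && (z j.+1 \in l j) }.

Lemma spanning_berge H z l : #|V| = m.+1 -> spanning_path H z l ->
  exists p es, hamiltonian_berge_path H x y p es.
Proof.
move=> cV [zi z0 zm li lH lz].
pose p := mkseq (fun i => z i.+1) m; pose es := mkseq l m.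
have xpE : x :: p = mkseq z m.+1.
  by rewrite /mkseq /= -z0 -[1]/(1 + 0) iotaDl -map_comp.
have up : uniq (x :: p).
  rewrite xpE; apply/mkseq_uniqP => i j; rewrite !inE !ltnS.
  exact: zi.
exists p, es; split.
- split=> //.
  + by rewrite !size_mkseq.
  + by apply/mkseq_uniqP => i j; rewrite !inE; apply: li.
  + by move=> e /mapP[i]; rewrite mem_iota add0n => /lH ? ->.
  + move=> i; rewrite size_mkseq xpE => im.
    rewrite !(nth_mkseq x) ?(nth_mkseq set0) ?ltnS //; last exact: ltnW.
    by rewrite subUset !sub1set lz.
- by rewrite (last_nth x) xpE size_mkseq nth_mkseq.
- apply/eqP; rewrite eqEcard subsetT cardsT cV.
  by rewrite cardsE (card_uniqP up) /= size_mkseq.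
Qed.

(** Cut at the special label: the path runs from [x] to the last vertex, through [e] to the first
    one, and on to [y]. Mirroring provides the orientation in which [y] precedes [x]. *)
Lemma close_path H S e : x != y -> valid H x y m S -> e \in fr H m S ->
  vbeg S \in e -> vend m S \in e -> exists z l, spanning_path H z l.
Proof.
move=> xy vS; wlog : S vS / vx S (sp S) = y /\ vx S (sp S).+1 = x.
  have sm := sp_lt vS; have /andP[] := lb_vx vS sm.
  rewrite (lb_sp vS) !in_set2 => s0 s1 wl.
  have ns : vx S (sp S) != vx S (sp S).+1.
    by apply/eqP => /(vx_inj vS); lia.
  have [Ey|Ny] := eqVneq (vx S (sp S)) y.
    apply: wl => //; split=> //.
    by move: s1 ns; rewrite Ey => /orP[/eqP//|/eqP->]; rewrite eqxx.
  have Ex : vx S (sp S) = x by move: s0; rewrite (negPf Ny) orbF => /eqP.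
  have Ey : vx S (sp S).+1 = y.
    by move: s1 ns; rewrite Ex => /orP[/eqP->|/eqP//]; rewrite eqxx.
  move=> eF be ae; apply: (wl (mir m S)); rewrite ?mir_fr ?mir_vbeg ?mir_vend //.
    exact: mir_valid.
  by rewrite /= (_ : m - (m.-1 - sp S) = (sp S).+1) 1?(_ : m - (m.-1 - sp S).+1 = sp S);
    lia || split.
move=> [sy sx] eF be ae; have sm := sp_lt vS; set s := sp S in sm sy sx.
have eN j : j < m -> lb S j <> e by move=> jm; apply/eqP/(fr_lb eF).
exists (fun i => if i < m - s then vx S (s.+1 + i) else vx S (i - (m - s))),
  (fun i => if i.+1 < m - s then lb S (s.+1 + i)
            else if i.+1 == m - s then e else lb S (i - (m - s))).
split.
- by move=> i j im jm; do 2!case: ifP => ?; move/(vx_inj vS); lia.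
- by rewrite subn_gt0 sm addn0.
- by rewrite ltnNge leq_subr /= subKn // ltnW.
- move=> i j im jm; do 2!(case: ifP => ?; last case: ifP => ?);
    (by move/(lb_inj vS); lia) || (by move/eN; lia) || (by move/esym/eN; lia) || lia.
- move=> j jm; case: ifP => j1; first by apply: (lb_edge vS); rewrite -/s; lia.
  case: eqP => j2; first exact: fr_edge eF.
  by apply: (lb_edge vS); rewrite -/s; lia.
- move=> j jm; case: (ltngtP j.+1 (m - s)) => j1.
  + by rewrite addnS; apply: (lb_vx vS); lia.
  + by rewrite subSn; [apply: (lb_vx vS)|]; lia.
  + by rewrite j1 subnn be andbT (_ : s.+1 + j = m) //; lia.
Qed.

Lemma open_path H e0 z l : 2 < r -> uniform r H -> #|e0| = r ->
  spanning_path (e0 |: H) z l ->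
  spanning_path H z l \/ exists S, valid H x y m S.
Proof.
move=> r2 uH ce [zi z0 zm li lH lz].
have [/existsP[[i im] /= /eqP iE]|/existsPn no] := boolP [exists i : 'I_m, l i == e0].
  (* The state runs from [z i.+1] to [y], passes to [x] through the pair at position [s], and ends
     in [z i]. *)
  right; pose s := m - i.+1.
  exists (State
    (fun t => if t <= s then z (i.+1 + t) else z (t - s.+1))
    (fun t => if t < s then l (i.+1 + t) else if t == s then [set x; y] else l (t - s.+1))
    s).
  have lN j : j < m -> l j <> [set x; y].
    move=> jm E; have : #|l j| = r.
      by have /setU1P[->//|] := lH j jm; apply: uH.
    by rewrite E cards2; lia.
  have lH' j : j < m -> j != i -> l j \in H.
    move=> jm ji; have /setU1P[jE|//] := lH j jm.
    by case/eqP: ji; apply: li => //; rewrite iE.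
  split=> /=; rewrite ?ltnn ?eqxx //.
  - by move=> a b am bm; rewrite /s; do 2!case: ifP => ?; move/zi; lia.
  - move=> a b am bm; rewrite /s; do 2!(case: ifP => ?; last case: ifP => ?);
    (by move/li; lia) || (by move/lN; lia) || (by move/esym/lN; lia) || lia.
  - by rewrite /s; lia.
  - move=> j jm; case: (ltngtP j s) => j1.
    + by rewrite addnS; apply: lz; lia.
    + by rewrite subSn; [apply: lz|]; lia.
    + rewrite j1 subnn z0 (_ : i.+1 + s = m) ?zm; last by rewrite /s; lia.
      by rewrite !in_set2 !eqxx orbT.
  - by move=> j jm; rewrite /s => js; case: ifP => j1;
      [|rewrite (negPf js)]; apply: lH'; lia.
left; split=> // j jm; have /setU1P[jE|//] := lH j jm.
by have := no (Ordinal jm); rewrite /= jE eqxx.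
Qed.

(** The label at [j] is the window of [r] cyclically consecutive vertices from [j] on. As [r <= m],
    a window never contains the vertex just before its start, so the windows are distinct. *)
Lemma complete_path H : #|V| = m.+1 -> x != y -> 1 < r <= m ->
  (forall e, #|e| = r -> e \in H) -> exists z l, spanning_path H z l.
Proof.
move=> cV xy /andP[r1 rm] all_r.
pose q := x :: rcons (enum (~: [set x; y])) y.
have sq : size q = m.+1.
  rewrite /= size_rcons -cardE; have := cardsC [set x; y].
  by rewrite cards2 xy cV => <-.
have uq : uniq q.
  rewrite /= rcons_uniq mem_rcons in_cons (negPf xy) !mem_enum !in_setC !in_set2.
  by rewrite !eqxx orbT enum_uniq.
have qi i j : i <= m -> j <= m -> nth x q i = nth x q j -> i = j.
  by move=> im jm /eqP; rewrite nth_uniq ?sq // => /eqP.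
pose c j u := if j + u <= m then j + u else j + u - m.+1.
pose w j : {set V} := [set nth x q (c j u) | u : 'I_r].
have cm j u : j < m -> u < r -> c j u <= m by rewrite /c; case: ifP; lia.
have ci j u u' : j < m -> u < r -> u' < r -> c j u = c j u' -> u = u'.
  by rewrite /c; do 2!case: ifP; lia.
have card_w j : j < m -> #|w j| = r.
  move=> jm; rewrite card_imset ?card_ord // => u u' E; apply: val_inj.
  have {}E := qi _ _ (cm _ _ jm (ltn_ord u)) (cm _ _ jm (ltn_ord u')) E.
  exact: ci E.
have in_w j t : j < m -> t <= m ->
    (nth x q t \in w j) = [exists u : 'I_r, c j u == t].
  move=> jm tm; apply/imsetP/existsP => [[u _ E]|[u /eqP <-]]; last by exists u.
  by exists u; apply/eqP/esym/(qi _ _ tm (cm _ _ jm (ltn_ord u)) E).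
exists (nth x q), w; split=> //.
- by rewrite -[m]/(m.+1.-1) -sq nth_last /= last_rcons.
- have lt_false i j : i < j < m -> w i = w j -> False.
    move=> /andP[ij jm] E; have im : i < m by lia.
    have : nth x q j \in w i.
      rewrite E in_w //; last exact: ltnW.
      by apply/existsP; exists (Ordinal (ltnW r1)); rewrite /c /= addn0 ltnW.
    rewrite in_w //; last exact: ltnW.
    case/existsP => u cu; have ur := ltn_ord u.
    have u0 : u.-1 < r by lia.
    have uE : j = i + u by move: cu; rewrite /c; case: ifP; lia.
    have : nth x q j.-1 \in w j.
      rewrite -E in_w; [|lia|lia]; apply/existsP; exists (Ordinal u0).
      by rewrite /c /=; case: ifP; lia.
    rewrite in_w; [|lia|lia]; case/existsP => u'; have := ltn_ord u'; rewrite /c; case: ifP; lia.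
  move=> i j im jm E; case: (ltngtP i j) => // ij; exfalso.
    by apply: (lt_false i j); rewrite ?ij.
  by apply: (lt_false j i); rewrite ?ij.
- by move=> j jm; apply: all_r; apply: card_w.
- move=> j jm; rewrite !in_w //; last exact: ltnW.
  apply/andP; split; apply/existsP.
    by exists (Ordinal (ltnW r1)); rewrite /c /= addn0 ltnW.
  by exists (Ordinal r1); rewrite /c /=; case: ifP; lia.
Qed.

Lemma degreeS H H' v : H \subset H' -> degree H v <= degree H' v.
Proof.
move=> HH; apply/subset_leq_card/subsetP => e; rewrite !inE => /andP[eH ->].
by rewrite (subsetP HH).
Qed.

Lemma spanning_path_reduction H D : #|V| = m.+1 -> x != y -> 2 < r <= m ->
  (forall H', uniform r H' -> (forall v, D <= degree H' v) -> stuck H' x y m r ->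
    forall S, valid H' x y m S -> False) ->
  uniform r H -> (forall v, D <= degree H v) -> exists z l, spanning_path H z l.
Proof.
move=> cV xy /andP[r2 rm] no.
pose miss H := #|[set e : {set V} | #|e| == r] :\: H|.
move: {2}(miss H) (leqnn (miss H)) => k.
elim: k H => [|k IH] H le uH dH.
  apply: complete_path => //; first by rewrite rm ltnW.
  move=> e /eqP er; move: le; rewrite leqn0 cards_eq0 => /eqP/setP/(_ e).
  by rewrite in_setD inE er in_set0 andbT => /negbFE.
apply: NNPP => nH; have [M0|[e0]] := set_0Vmem ([set e : {set V} | #|e| == r] :\: H).
  by apply: nH; apply: IH => //; rewrite /miss M0 cards0.
rewrite in_setD inE => /andP[e0H /eqP e0r].
have [] : exists z l, spanning_path (e0 |: H) z l.
  apply: IH.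
  - have : [set e : {set V} | #|e| == r] :\: (e0 |: H) \proper
        [set e : {set V} | #|e| == r] :\: H.
      apply/properP; split; first by apply/setDS/subsetUr.
      by exists e0; rewrite in_setD ?in_setU1 ?eqxx //= inE e0H e0r eqxx.
    by move/proper_card => lt; move: (leq_trans lt le); rewrite ltnS.
  - by move=> e /setU1P[->|/uH].
  - by move=> v; apply: leq_trans (dH v) (degreeS v (subsetUr _ _)).
move=> z [l /(open_path r2 uH e0r)[zl|[S vS]]]; first by apply: nH; exists z, l.
apply: (no H uH dH _ S vS); split=> // S' vS' e eF be ae; apply: nH.
exact: close_path eF be ae.
Qed.

End SpanningPath.

(** * The degree conditions of the theorem *)

Lemma min_degree_le (V : finType) (H : {set {set V}}) v :
  min_degree H <= degree H v.
Proof.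
rewrite /min_degree; have : v \in index_enum V by rewrite mem_index_enum.
elim: (index_enum V) => // u s IH; rewrite in_cons big_cons geq_min.
by case/predU1P => [->|/IH ->]; rewrite ?leqnn ?orbT.
Qed.

Lemma uniform_card_degree (V : finType) (H : {set {set V}}) v :
  uniform #|V| H -> degree H v <= 1.
Proof.
move=> uH; rewrite -(cards1 [set: V]); apply/subset_leq_card/subsetP => e.
rewrite inE => /andP[/uH eV _]; rewrite in_set1 eqEcard subsetT cardsT eV.
exact: leqnn.
Qed.

Lemma valid_free_neq0 (V : finType) (H : {set {set V}}) (x y : V) (m r : nat)
    (S : state V) :
  stuck H x y m r -> valid H x y m S -> r * m.-1 < \sum_(v : V) degree H v ->
  fr H m S != set0.
Proof.
move=> W vS; rewrite (degree_sum (stuck_uniform W)) ltn_mul2l => /andP[_ lt].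
rewrite -card_gt0; have := card_H_le W vS; move: lt; lia.
Qed.

Theorem theorem3 (n r : nat) (V : finType) (H : {set {set V}})
    (hr : 3 <= r) (hrn : r <= n) (hV : #|V| = n) (hH : uniform r H)
    (hdeg : [\/ 2 * r <= n /\ 'C(n./2, r.-1) + 1 <= min_degree H,
                [/\ n < 2 * r, 6 <= n & r.-1 <= min_degree H]
              | [/\ r = 3, n = 5 & 3 <= min_degree H]]) :
  hamiltonian_connected H.
Proof.
move=> x y xy; case: n => [|m] in hrn hV hdeg *; first lia.
have degmin v : min_degree H <= degree H v by apply: min_degree_le.
(* Two edges at a vertex exclude [r = n], where only one edge is possible. *)
have lb2 : 1 < min_degree H.
  case: hdeg => [[rn]|[_ _]|[_ _]]; try lia.
  have : 0 < 'C(m.+1./2, r.-1) by rewrite bin_gt0; lia.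
  by lia.
have rm : 2 < r <= m.
  rewrite hr /=; have [//|mr] := leqP r m; have rV : r = #|V| by lia.
  have := leq_trans lb2 (leq_trans (degmin x) (uniform_card_degree x _)).
  by rewrite -rV => /(_ hH).
have [z [l zl]] : exists z l, spanning_path x y m H z l.
  apply: (spanning_path_reduction (D := min_degree H) hV xy rm _ hH degmin).
  move=> H' uH' dH' W S vS.
  have sumD (c : nat) : c <= min_degree H -> r * m.-1 < m.+1 * c -> fr H' m S != set0.
    move=> cD lt; apply: (valid_free_neq0 W vS); apply: leq_trans lt _.
    rewrite -hV -sum_nat_const; apply: leq_sum => v _; exact: leq_trans cD (dH' v).
  case: hdeg => [[rn dk]|[nr n6 dr]|[rE mE dr]].
  - have rk : r <= m.+1./2 by lia.
    have mk : m.+1 = m.+1./2.*2 \/ m = m.+1./2.*2.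
      have := odd_double_half m.+1; case: odd; lia.
    apply: (small_r_false W rk mk _ vS) => [v|]; first exact: leq_trans dk (dH' v).
    apply: (sumD r.+1); last by nia.
    have := @bin_ge_upper (m.+1./2) r.-1; move: dk; lia.
  - apply: (large_r_false W vS) => //.
    (* [r * m.-1 < m.+1 * r.-1] amounts to [m.+1 < 2 * r]. *)
    + by apply: (sumD r.-1) => //; nia.
    + by move=> v; apply: leq_trans dr (dH' v).
    + by move=> r3; lia.
  - apply: (large_r_false W vS) => [|||_ v]; try lia.
    + by apply: (sumD 3) => //; lia.
    + by move=> v; have := dH' v; lia.
    + by have := dH' v; lia.
exact: spanning_berge hV zl.
Qed.
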